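(* Let $n\ge1$ and $\varepsilon\in(0,\frac12)$. Inside the unit cube $(0,1)^n$ any two bodies $A$ and $B$ of volume $\varepsilon$ are at a distance at most $$-2\,\Phi^{-1}(\varepsilon).$$ The function $-2\Phi^{-1}(\varepsilon)$ is asymptotically equivalent to $\frac{2}{\sqrt\pi}\sqrt{-\ln\varepsilon}$ as $\varepsilon\to0^+$ (the ratio tends to $1$).
   Context: $\Phi(a)=\int_{-\infty}^{a}e^{-\pi x^2}\,dx$, an increasing bijection $\mathbb{R}\to(0,1)$, and $\Phi^{-1}$ is its inverse. Bodies are measurable subsets of $(0,1)^n$; volume is Lebesgue measure. The distance between non-empty sets is $\operatorname{dist}(A,B)=\inf_{x\in A,\,y\in B}\|x-y\|_2$ (Euclidean distance). *)

(* Defs.v *)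
From HB Require Import structures.
From mathcomp Require Import all_boot all_order all_algebra.
From mathcomp Require Import all_classical all_reals all_analysis.

Set Implicit Arguments.
Unset Strict Implicit.
Unset Printing Implicit Defensive.

Import Order.TTheory GRing.Theory Num.Theory.
Import numFieldNormedType.Exports.

Local Open Scope classical_set_scope.
Local Open Scope ring_scope.

(* R^n is represented by n.-tuple (measurableTypeR R), which carries the product
   of the Borel sigma-algebras; its Lebesgue measure is built coordinate by
   coordinate from the library's product measure. *)
Section lebesgue_cons.
Context (R : realType) (n : nat).
Variable m : {sigma_finite_measure set (n.-tuple (measurableTypeR R)) -> \bar R}.

Definition cons_pair (p : measurableTypeR R * n.-tuple (measurableTypeR R)) :
  n.+1.-tuple (measurableTypeR R) := [tuple of p.1 :: p.2].

Lemma measurable_cons_pair : measurable_fun setT cons_pair.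
Proof. exact: measurable_cons. Qed.

Definition lebesgue_cons : set (n.+1.-tuple (measurableTypeR R)) -> \bar R :=
  pushforward (@lebesgue_measure R \x m)%E cons_pair.

Let lebesgue_cons0 : lebesgue_cons set0 = 0%E.
Proof. by rewrite /lebesgue_cons /pushforward preimage_set0 (measure0 (@lebesgue_measure R \x m)%E). Qed.

Let lebesgue_cons_ge0 A : (0 <= lebesgue_cons A)%E.
Proof. exact: (measure_ge0 (@lebesgue_measure R \x m)%E). Qed.

Let lebesgue_cons_sigma_additive : semi_sigma_additive lebesgue_cons.
Proof.
move=> F mF tF mUF; rewrite /lebesgue_cons /pushforward preimage_bigcup.
have mpre A : measurable A -> measurable (cons_pair @^-1` A).
  by move=> mA; rewrite -[X in measurable X]setTI; exact: measurable_cons_pair.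
apply: measure_semi_sigma_additive => [k||].
- exact: mpre.
- apply/trivIsetP => /= i j _ _ ij; rewrite -preimage_setI.
  by move/trivIsetP : tF => /(_ _ _ _ _ ij) -> //; rewrite preimage_set0.
- by rewrite -preimage_bigcup; exact: mpre.
Qed.

HB.instance Definition _ := isMeasure.Build _ _ _ lebesgue_cons
  lebesgue_cons0 lebesgue_cons_ge0 lebesgue_cons_sigma_additive.

Let lebesgue_cons_sigma_finite : sigma_finite setT lebesgue_cons.
Proof.
have /sigma_finiteP[F [FT ndF Ffin]] := sigma_finiteT (@lebesgue_measure R).
have /sigma_finiteP[G [GT ndG Gfin]] := sigma_finiteT m.
pose u (t : n.+1.-tuple (measurableTypeR R)) := (thead t, [tuple of behead t]).
have mu' : measurable_fun setT u.
  apply: measurable_fun_pair; first exact: measurable_tnth.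
  exact: measurable_behead.
have uK : u \o cons_pair = id.
  by apply/funext => -[x t]; congr pair; exact: val_inj.
exists (fun k => u @^-1` (F k `*` G k)) => [|k].
  rewrite -preimage_bigcup predeqE => t; split=> // _.
  have [i _ Fi] : (\bigcup_i F i) (u t).1 by rewrite -FT.
  have [j _ Gj] : (\bigcup_i G i) (u t).2 by rewrite -GT.
  exists (maxn i j) => //; split.
  - by move: Fi; exact/subsetPset/ndF/leq_maxl.
  - by move: Gj; exact/subsetPset/ndG/leq_maxr.
have [mF Fk] := Ffin k; have [mG Gk] := Gfin k.
split; first by rewrite -[X in measurable X]setTI; apply: mu' => //; exact: measurableX.
rewrite /lebesgue_cons /pushforward -comp_preimage uK preimage_id.
by rewrite product_measure1E// lte_mul_pinfty// ge0_fin_numE.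
Qed.

HB.instance Definition _ := Measure_isSigmaFinite.Build _ _ _ lebesgue_cons
  lebesgue_cons_sigma_finite.

End lebesgue_cons.

Fixpoint lebesgue_tuple (R : realType) (n : nat) :
    {sigma_finite_measure set (n.-tuple (measurableTypeR R)) -> \bar R} :=
  match n with
  | 0 => \d_([tuple] : 0.-tuple (measurableTypeR R))
  | n'.+1 => lebesgue_cons (lebesgue_tuple R n')
  end.

Lemma lebesgue_tuple_box (R : realType) (n : nat)
    (F : 'I_n -> set (measurableTypeR R)) :
  (forall i, measurable (F i)) ->
  lebesgue_tuple R n [set x | forall i, F i (tnth x i)] =
  (\prod_(i < n) lebesgue_measure (F i))%E.
Proof.
elim: n F => [|n IHn] F mF.
  rewrite big_ord0 /= diracE mem_set //=; first by case.
pose G (i : 'I_n) := F (lift ord0 i).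
have mG i : measurable (G i) by exact: mF.
rewrite big_ord_recl -[in RHS](IHn G mG) /= /lebesgue_cons /pushforward.
rewrite (_ : _ @^-1` _ =
  F ord0 `*` [set x | forall i, G i (tnth x i)]); last first.
  apply/seteqP; split=> -[x t] /=.
    move=> H; split; first by have := H ord0.
    by move=> i; have := H (lift ord0 i); rewrite /= tnthS.
  move=> [H0 H] i; case: (unliftP ord0 i) => [j|] -> //.
  by rewrite /= tnthS; exact: H.
rewrite product_measure1E //.
rewrite (_ : [set x | _] = \bigcap_(i in [set: 'I_n]) ((@tnth _ _ ^~ i) @^-1` G i)).
  apply: fin_bigcap_measurable => // i _.
  by rewrite -[X in measurable X]setTI; exact: measurable_tnth.
by apply/seteqP; split=> t /= H i; [move=> _; exact: H | exact: (H i I)].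
Qed.

(* The completion, as for the library's completed_lebesgue_measure: a set is
   measurable when it is Caratheodory-measurable, i.e. Lebesgue measurable and
   not only Borel. *)
Definition lebesgue_measurable (R : realType) (n : nat)
    (A : set (n.-tuple R)) : Prop :=
  ((lebesgue_tuple R n)^*%mu).-cara.-measurable A.

Definition volume (R : realType) (n : nat) (A : set (n.-tuple R)) : \bar R :=
  @completed_measure_extension _ _ _ (lebesgue_tuple R n) A.

Definition unit_cube (R : realType) (n : nat) : set (n.-tuple R) :=
  [set x | forall i, 0 < tnth x i < 1].

Definition body (R : realType) (n : nat) (A : set (n.-tuple R)) : Prop :=
  lebesgue_measurable A /\ A `<=` @unit_cube R n.

Definition eucl_dist (R : realType) (n : nat) (x y : n.-tuple R) : R :=
  Num.sqrt (\sum_(i < n) (tnth x i - tnth y i) ^+ 2).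

(* The real-valued inf is the true infimum only for non-empty A and B. *)
Definition set_dist (R : realType) (n : nat) (A B : set (n.-tuple R)) : R :=
  inf [set eucl_dist x y | x in A & y in B].

Definition Phi (R : realType) (a : R) : R :=
  \int[@lebesgue_measure R]_(x in `]-oo, a]) expR (- pi * x ^+ 2).

(* Phi is a bijection from R onto ]0, 1[; outside this interval the partial
   inverse takes a default value. *)
Definition Phi_inv (R : realType) : R -> R := pinv [set: R] (@Phi R).

(* Main.v *)
From HB Require Import structures.
Require Import Defs.
From mathcomp Require Import all_boot all_order all_algebra.
From mathcomp Require Import all_classical all_reals all_analysis.
From mathcomp Require Import ring lra zify.

Import Order.TTheory GRing.Theory Num.Theory.
Import numFieldNormedType.Exports.

Local Open Scope classical_set_scope.
Local Open Scope ring_scope.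

(** The distance bound is the Gaussian isoperimetric inequality with profile
    [I p = gauss (Psi p)], where [gauss x = exp (- pi x^2)] is the derivative of
    [Phi] and [Psi] its inverse.  Suppose that a family of functions with values
    in ]0, 1[ interpolates, at parameter [c], between being close to 1 where the
    distance to A is less than [c] and close to 0 where it is more.  If the mean
    [M c] of the functions satisfies [I (M c) <= M' c], then [Psi (M c)] grows
    at least as fast as [c], because [Psi' = 1 / I].  For small positive [c] the
    mean is almost at least the volume [eps] of A; for [c] slightly below
    [dist(A, B)] it is almost at most [1 - eps], since B has not been reached.
    Hence
    [dist(A, B) <= Psi (1 - eps) - Psi eps = - 2 Psi eps].

    The differential inequality comes from Bobkov's functional inequality on the
    discrete cube: for [f] from {0, 1}^N to ]0, 1[,
    [I (E f) <= E sqrt (I(f)^2 + 2 pi |D f|^2)], where [D f] collects the halved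
    increments under flipping one bit.  It follows by induction on [N] from the
    case [N = 1] ([bobkov_two_point]), because [sqrt (a^2 + b^2)] is a norm
    ([bobkov_cube]).

    The solid cube is reached from the discrete one without a central limit
    theorem.  Toss [2m] coins for each coordinate, and cut ]0, 1] into
    consecutive cells whose lengths are the probabilities of the possible
    numbers of heads.  The coins then pick each cell of ]0, 1]^n with a
    probability equal to its volume, so the picked cell meets a given set with
    a probability at least the volume of that set ([volume_le_coin_mean]).
    Flipping one coin moves one coordinate by at most the central binomial
    probability [d].  Wallis' bound [pi m d^2 <= 1] ([central_atom_sqr_le]) says
    that the [2m] coins of a coordinate contribute together at most the square
    of one partial derivative to [2 pi |D f|^2]: the constant is sharp, so
    nothing is lost in the limit of large [m].

    The sum of squared increments along the coordinate axes is controlled by the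
    squared Euclidean Lipschitz constant only for functions that are smooth at
    the scale [d]; the distance to A itself is not.  It is replaced by a soft
    minimum of squared distances to finitely many points of A,
    [- kap * ln (mean of exp (- |x - a|^2 / kap))], whose square root has
    gradient of norm at most 1 by Gibbs' variational principle
    ([soft_distance_function]).  With [f = Phi (lam * (c - G))], [G] being this soft
    distance, the discrete inequality reads
    [I (M c) <= sqrt (1 + lam^2) / lam * M' c] up to an error that vanishes with
    [d] ([soft_volume_isoperimetry]), and the factor tends to 1 as [lam] grows.

    For the asymptotics, [gauss (z + 1) <= Phi (- z) <= gauss z] for [1 <= z]
    ([Phi_tail_ge], [Phi_tail_le]).  If [Phi (- z) = eps], this says that
    [sqrt (- ln eps)] lies between [sqrt pi * z] and [sqrt pi * (z + 1)]. *)

(** * The Gaussian distribution function *)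

Lemma le_of_derive_ge0 (R : realType) (f df : R -> R) (a b : R) :
  a <= b -> (forall x, a <= x <= b -> is_derive x 1 f (df x)) ->
  (forall x, a <= x <= b -> 0 <= df x) -> f a <= f b.
Proof.
move=> ab fD df0.
have [||c cab E] := @MVT_segment R f df a b ab.
- by move=> x; rewrite in_itv/= => /andP[ax xb]; apply: fD; rewrite !ltW.
- apply: derivable_within_continuous => x; rewrite in_itv/= => xab.
  by have [] := fD _ xab.
- by rewrite -subr_ge0 E mulr_ge0 ?subr_ge0// df0// -in_itv.
Qed.

Definition gauss {R : realType} (x : R) : R := expR (- pi * x ^+ 2).

Section gauss_cdf.
Context {R : realType}.
Notation phi := (@gauss R).
Notation Phi := (@Phi R).
Notation mu := (@lebesgue_measure R).

Lemma gauss_gt0 x : 0 < phi x. Proof. exact: expR_gt0. Qed.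

Lemma gaussN x : phi (- x) = phi x.
Proof. by rewrite /gauss sqrrN. Qed.

Lemma gauss_le1 x : phi x <= 1.
Proof. by rewrite /gauss -expR0 ler_expR mulNr oppr_le0 mulr_ge0 ?pi_ge0 ?sqr_ge0. Qed.

Lemma is_derive_gauss (x : R) : is_derive x (1 : R) phi (- (2 * pi * x) * phi x).
Proof.
have -> : phi = expR \o (fun x => - pi * x ^+ 2) by [].
apply: is_derive_eq.
by rewrite /GRing.scale/= /gauss; ring.
Qed.

Lemma gauss_le (x y : R) : `|x| <= `|y| -> phi y <= phi x.
Proof.
move=> xy; rewrite /gauss ler_expR !mulNr lerN2 ler_pM2l ?pi_gt0//.
by rewrite -(real_normK (num_real x)) -(real_normK (num_real y)) lerXn2r ?nnegrE.
Qed.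

Lemma continuous_gauss : continuous phi.
Proof. by move=> x; apply: differentiable_continuous; apply/derivable1_diffP; have [] := is_derive_gauss x. Qed.

Let sd : R := (Num.sqrt (2 * pi))^-1.

Let sd_neq0 : sd != 0.
Proof. by rewrite invr_eq0 sqrtr_eq0 -ltNge mulr_gt0 ?pi_gt0. Qed.

(** This gives access to the total mass and to the limits of the distribution
    function. *)
Lemma gauss_normal_pdf : phi = normal_pdf 0 sd.
Proof.
have p0 := pi_gt0 R.
have sd2 : sd ^+ 2 = (2 * pi)^-1 by rewrite exprVn sqr_sqrtr// mulr_ge0// ltW.
apply/funext => x; rewrite normal_pdfE// /normal_peak /normal_fun sd2 subr0.
have -> : (2 * pi)^-1 * pi *+ 2 = 1 :> R.
  by rewrite -mulr_natl invfM mulfVK ?divff// gt_eqF.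
rewrite sqrtr1 invr1 mul1r /gauss; congr expR.
have -> : (2 * pi)^-1 *+ 2 = pi^-1 :> R.
  by rewrite -(mulr_natl (2 * pi)^-1) invfM mulrA divff// mul1r.
by rewrite invrK mulrC mulNr mulrN.
Qed.

Lemma integrable_gauss (A : set R) : measurable A -> mu.-integrable A (EFin \o phi).
Proof.
move=> mA; apply: (@integrableS _ _ _ _ setT) => //.
by rewrite gauss_normal_pdf; exact: integrable_normal_pdf.
Qed.

Lemma is_derive_Phi (x : R) : is_derive x (1 : R) Phi (phi x).
Proof.
have xu : x < x + 1 by rewrite ltrDl.
have [] := @continuous_FTC1 R phi -oo%O x (x + 1) xu.
- exact: integrable_gauss.
- by rewrite ltNyr.
- exact: continuous_gauss.
- by move=> D E; split => //; rewrite -derive1E.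
Qed.

Lemma continuous_Phi : continuous Phi.
Proof. by move=> x; apply: differentiable_continuous; apply/derivable1_diffP; have [] := is_derive_Phi x. Qed.

Lemma Phi_mvt (x y : R) : x <= y ->
  exists2 c, x <= c <= y & Phi y - Phi x = phi c * (y - x).
Proof.
move=> xy; have [||c cxy E] := @MVT_segment R Phi phi x y xy.
- by move=> z _; exact: is_derive_Phi.
- exact/continuous_subspaceT/continuous_Phi.
- by exists c => //; rewrite -in_itv.
Qed.

Lemma Phi_lt : {homo Phi : x y / x < y}.
Proof.
move=> x y xy; have [c _ E] := Phi_mvt _ _ (ltW xy).
by rewrite -subr_gt0 E mulr_gt0 ?gauss_gt0 ?subr_gt0.
Qed.

Lemma Phi_mono : {mono Phi : x y / x <= y}.
Proof. exact: le_mono Phi_lt. Qed.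

Lemma Phi_ge0 x : 0 <= Phi x.
Proof. by apply: Rintegral_ge0 => y _; rewrite ltW ?gauss_gt0. Qed.

Lemma Phi_gt0 x : 0 < Phi x.
Proof. by apply: le_lt_trans (Phi_ge0 (x - 1)) _; apply: Phi_lt; lra. Qed.

Let idTR : measurableTypeR R -> R := idfun.

HB.instance Definition _ :=
  @isMeasurableFun.Build _ _ _ _ idTR (@measurable_id _ _ setT).

Let Phi_cdf x : (Phi x)%:E = cdf (idTR : {RV (normal_prob (0:R) sd) >-> R}) x.
Proof.
rewrite /cdf /distribution /= /pushforward/= /Defs.Phi /Rintegral fineK.
  by rewrite -/gauss /normal_prob -gauss_normal_pdf.
exact/integrable_fin_num/integrable_gauss.
Qed.

Lemma cvg_Phiy : Phi x @[x --> +oo] --> (1 : R).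
Proof.
have /fine_cvg := cvg_cdfy1 (idTR : {RV (normal_prob (0:R) sd) >-> R}).
by apply: cvg_trans; apply: near_eq_cvg; near=> x; rewrite /comp -Phi_cdf.
Unshelve. all: end_near. Qed.

Lemma cvg_PhiNy : Phi x @[x --> -oo] --> (0 : R).
Proof.
have /fine_cvg := cvg_cdfNy0 (idTR : {RV (normal_prob (0:R) sd) >-> R}).
by apply: cvg_trans; apply: near_eq_cvg; near=> x; rewrite /comp -Phi_cdf.
Unshelve. all: end_near. Qed.

Lemma Phi_gt (e : R) : e < 1 -> exists x, e < Phi x.
Proof.
move=> e1; have /cvgrPdist_lt/(_ (1 - e)) := cvg_Phiy.
rewrite subr_gt0 => /(_ e1) H.
near (pinfty_nbhs R) => x; exists x.
have : `|1 - Phi x| < 1 - e by near: x.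
by move=> /(le_lt_trans (ler_norm _)); lra.
Unshelve. all: end_near. Qed.

Lemma Phi_lt_eps (e : R) : 0 < e -> exists x, Phi x < e.
Proof.
move=> e0; have /cvgrPdist_lt/(_ e e0) H := cvg_PhiNy.
near (ninfty_nbhs R) => x; exists x.
have : `|0 - Phi x| < e by near: x.
by rewrite sub0r normrN => /(le_lt_trans (ler_norm _)).
Unshelve. all: end_near. Qed.

Lemma Phi_lt1 x : Phi x < 1.
Proof.
rewrite ltNge; apply/negP => x1.
have /Phi_lt y1 : x < x + 1 by rewrite ltrDl.
have /cvgrPdist_lt/(_ (Phi (x + 1) - 1)) := cvg_Phiy.
have -> : 0 < Phi (x + 1) - 1 by lra.
move=> /(_ isT) H.
near (pinfty_nbhs R) => y.
have : `|1 - Phi y| < Phi (x + 1) - 1 by near: y.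
rewrite distrC => /(le_lt_trans (ler_norm _)).
have : Phi (x + 1) <= Phi y by rewrite Phi_mono; near: y; apply: nbhs_pinfty_ge; rewrite num_real.
by lra.
Unshelve. all: end_near. Qed.

(** The sum [Phi x + Phi (- x)] has derivative zero, and tends to 1 at infinity. *)
Lemma PhiN x : Phi (- x) = 1 - Phi x.
Proof.
have D y : is_derive y (1 : R) (fun z => Phi z + Phi (- z)) 0.
  have -> : (fun z => Phi z + Phi (- z)) = Phi + (Phi \o -%R) by [].
  have Dy := is_derive_Phi y; have DNy := is_derive_Phi (- y).
  by apply: is_derive_eq; rewrite gaussN mulrN1 subrr.
have cst y : Phi y + Phi (- y) = Phi x + Phi (- x).
  by have := @is_derive_0_is_cst R _ y x D.
have L : Phi y + Phi (- y) @[y --> +oo] --> (1 + 0 : R).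
  apply: cvgD; first exact: cvg_Phiy.
  exact: ((cvgNy_compNP Phi (nbhs (0 : R))).1 cvg_PhiNy).
move: L; under eq_fun do rewrite cst.
by move/(cvg_unique _ (cvg_cst _)); rewrite addr0 => /(_ (@Rhausdorff R)); lra.
Qed.

Notation Psi := (@Phi_inv R).

Lemma PhiK : cancel Phi Psi.
Proof.
move=> x; apply: pinvKV; rewrite ?inE//.
by move=> y z _ _; exact/inc_inj/Phi_mono.
Qed.

Lemma PsiK (p : R) : 0 < p < 1 -> Phi (Psi p) = p.
Proof.
move=> /andP[p0 p1]; have [a ap] := Phi_lt_eps _ p0; have [b pb] := Phi_gt _ p1.
have ab : a <= b by rewrite -Phi_mono; lra.
have [||c _ <-] := @IVT R Phi a b p ab.
- exact/continuous_subspaceT/continuous_Phi.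
- have fab : Phi a <= Phi b by rewrite Phi_mono.
  by rewrite (min_idPl fab) (max_idPr fab) !ltW.
- by rewrite PhiK.
Qed.

Lemma Psi_le (p x : R) : 0 < p < 1 -> (Psi p <= x) = (p <= Phi x).
Proof. by move=> p01; rewrite -Phi_mono PsiK. Qed.

Lemma le_Psi (p x : R) : 0 < p < 1 -> (x <= Psi p) = (Phi x <= p).
Proof. by move=> p01; rewrite -Phi_mono PsiK. Qed.

Lemma PsiN (p : R) : 0 < p < 1 -> Psi (1 - p) = - Psi p.
Proof. by move=> p01; rewrite -{1}(PsiK p)// -PhiN PhiK. Qed.

Lemma is_derive_Psi (p : R) : 0 < p < 1 ->
  is_derive p (1 : R) Psi (phi (Psi p))^-1.
Proof.
move=> p01; rewrite -{1}(PsiK p)//.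
apply: (@is_derive_inverse R Phi).
- by near=> z; exact: PhiK.
- by near=> z; exact: continuous_Phi.
- exact: is_derive_Phi.
- by rewrite gt_eqF ?gauss_gt0.
Unshelve. all: end_near. Qed.

(** The mean value theorem on an interval of length 1 to the left of [- z]. *)
Lemma Phi_tail_ge (z : R) : 0 <= z -> phi (z + 1) <= Phi (- z).
Proof.
move=> z0; have le1 : - (z + 1) <= - z by lra.
have [c /andP[zc cz] E] := Phi_mvt _ _ le1.
have P0 := Phi_ge0 (- (z + 1)).
have dz : - z - - (z + 1) = 1 by ring.
suff : phi (z + 1) <= phi c by move: E; rewrite dz; lra.
by apply: gauss_le; rewrite ler0_norm ?ger0_norm; lra.
Qed.

(** The difference [phi - Phi] is nondecreasing on ]-oo, -1], where
    [- 2 pi x >= 1], and it is bounded below by [- Phi], which tends to 0. *)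
Lemma Phi_tail_le (z : R) : 1 <= z -> Phi (- z) <= phi z.
Proof.
move=> z1; rewrite leNgt; apply/negP => lt.
pose K x := phi x - Phi x.
have [y Py] := Phi_lt_eps (Phi (- z) - phi z) ltac:(lra).
have yz : y <= - z by rewrite -Phi_mono; have := gauss_gt0 z; lra.
have : K y <= K (- z).
  apply: (@le_of_derive_ge0 R K (fun x => - (2 * pi * x) * phi x - phi x)) => //.
    move=> x _; have Dg := is_derive_gauss x; have DP := is_derive_Phi x.
    by apply: is_deriveB.
  move=> x /andP[_ xz]; rewrite -[X in _ - X]mul1r -mulrBl mulr_ge0 ?(ltW (gauss_gt0 _))//.
  have := pi_ge2 R; nra.
by rewrite /K gaussN; have := gauss_gt0 y; lra.
Qed.

End gauss_cdf.

(** * Asymptotics of the Gaussian quantile *)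

Section tail_asymptotics.
Context {R : realType}.
Notation Psi := (@Phi_inv R).

(** The two tail bounds, after taking logarithms and square roots. *)
Lemma sqrt_ln_Psi_bounds (p : R) : 0 < p < 1 -> 1 <= - Psi p ->
  Num.sqrt pi * - Psi p <= Num.sqrt (- ln p) <= Num.sqrt pi * (- Psi p + 1).
Proof.
move=> p01 z1; set z := - Psi p in z1 *.
have pz : p = Phi (- z) by rewrite opprK PsiK.
have p0 : 0 < p by case/andP: p01.
have gaussE y : - ln (gauss y) = pi * y ^+ 2 :> R by rewrite /gauss expRK mulNr opprK.
have sqrtE y : 0 <= y -> Num.sqrt pi * y = Num.sqrt (pi * y ^+ 2) :> R.
  by move=> y0; rewrite sqrtrM ?pi_ge0// sqrtr_sqr ger0_norm.
rewrite !sqrtE; [|lra|lra].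
rewrite !ler_wsqrtr// -gaussE lerN2 ler_ln ?posrE ?gauss_gt0//.
  by rewrite {1}pz; exact: Phi_tail_le.
by rewrite pz; apply: Phi_tail_ge; lra.
Qed.

Lemma Phi_inv_asymptotics :
  (- 2 * Psi eps / (2 / Num.sqrt pi * Num.sqrt (- ln eps)))
    @[eps --> (0 : R)^'+] --> (1 : R).
Proof.
apply/cvgrPdist_lt => e e0.
(* With z the opposite quantile, the ratio lies in [z / (z + 1), 1], and
   z >= M makes 1 / (z + 1) smaller than e. *)
pose M := Num.max 1 e^-1.
have M1 : 1 <= M by rewrite le_max lexx.
have Me : e^-1 <= M by rewrite le_max lexx orbT.
near=> p.
have p0 : 0 < p by near: p; exact: nbhs_right_gt.
have pM : p < Phi (- M) by near: p; apply: nbhs_right_lt; exact: Phi_gt0.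
have p01 : 0 < p < 1 by rewrite p0 (lt_trans pM) ?Phi_lt1.
have zM : M <= - Psi p by rewrite lerNr Psi_le// ltW.
have /andP[lo up] := sqrt_ln_Psi_bounds p p01 (le_trans M1 zM).
set z := - Psi p in zM lo up *; set L := Num.sqrt (- ln p) in lo up *.
have s0 : 0 < Num.sqrt (pi : R) by rewrite sqrtr_gt0 pi_gt0.
have L0 : 0 < L by apply: lt_le_trans lo; rewrite mulr_gt0//; lra.
have -> : - 2 * Psi p / (2 / Num.sqrt pi * L) = Num.sqrt pi * z / L.
  have -> : Psi p = - z by rewrite opprK.
  by field; rewrite !gt_eqF.
have z1 : 0 < z + 1 by lra.
have r1 : Num.sqrt pi * z / L <= 1 by rewrite ler_pdivrMr// mul1r.
rewrite ger0_norm ?subr_ge0//.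
suff : 1 - (z + 1)^-1 <= Num.sqrt pi * z / L.
  suff : (z + 1)^-1 < e by lra.
  by rewrite invf_plt ?posrE//; lra.
rewrite ler_pdivlMr// (le_trans (ler_wpM2l _ up))//.
  by rewrite subr_ge0 invf_le1//; lra.
have -> : (1 - (z + 1)^-1) * (Num.sqrt pi * (z + 1)) = Num.sqrt pi * z.
  by field; rewrite gt_eqF.
by [].
Unshelve. all: end_near. Qed.

End tail_asymptotics.

(** * The two-point inequality *)

Section two_point.
Context {R : realType}.
Notation Psi := (@Phi_inv R).
Notation phi := (@gauss R).

(** The Gaussian isoperimetric profile: the density at the boundary of the
    half-line of mass [p]. *)
Definition gauss_profile {R : realType} (p : R) : R := gauss (@Phi_inv R p).
Notation I := (@gauss_profile R).
Let J p := Psi p * I p.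

Lemma gauss_profile_gt0 (p : R) : 0 < I p.
Proof. exact: gauss_gt0. Qed.

Lemma is_derive_gauss_profile (p : R) : 0 < p < 1 ->
  is_derive p (1 : R) I (- (2 * pi * Psi p)).
Proof.
move=> p01; have DP := is_derive_Psi p p01; have DG := is_derive_gauss (Psi p).
have -> : I = phi \o Psi by [].
by apply: is_derive_eq; rewrite mulfK// gt_eqF ?gauss_gt0.
Qed.

Let is_derive_sqrI (p : R) : 0 < p < 1 ->
  is_derive p (1 : R) (fun q => I q ^+ 2) (- (4 * pi * J p)).
Proof.
move=> p01; have DI := is_derive_gauss_profile p p01.
have -> : (fun q => I q ^+ 2) = I ^+ 2 by apply/funext.
by apply: is_derive_eq; rewrite /GRing.scale/= /J; ring.
Qed.

Let is_derive_J (p : R) : 0 < p < 1 ->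
  is_derive p (1 : R) J (1 - 2 * pi * Psi p ^+ 2).
Proof.
move=> p01; have DI := is_derive_gauss_profile p p01.
have DP := is_derive_Psi p p01.
have -> : J = Psi * I by apply/funext.
apply: is_derive_eq; rewrite /GRing.scale/= -/(I p) mulfV ?gt_eqF ?gauss_gt0//.
by ring.
Qed.

Let is_derive_sqrPsi (p : R) : 0 < p < 1 ->
  is_derive p (1 : R) (fun q => Psi q ^+ 2) (2 * (Psi p / I p)).
Proof.
move=> p01; have DP := is_derive_Psi p p01.
have -> : (fun q => Psi q ^+ 2) = Psi ^+ 2 by apply/funext.
by apply: is_derive_eq; rewrite /GRing.scale/= -/(I p); ring.
Qed.

Let is_derive_shiftr (f : R -> R) (c t df : R) :
  is_derive (c + t) (1 : R) f df -> is_derive t (1 : R) (fun s => f (c + s)) df.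
Proof.
move=> Df; have -> : (fun s => f (c + s)) = f \o (cst c + id) by [].
by apply: is_derive_eq; rewrite add0r mulr1.
Qed.

Let is_derive_shiftl (f : R -> R) (c t df : R) :
  is_derive (c - t) (1 : R) f df -> is_derive t (1 : R) (fun s => f (c - s)) (- df).
Proof.
move=> Df; have -> : (fun s => f (c - s)) = f \o (cst c - id) by [].
by apply: is_derive_eq; rewrite add0r mulrN mulr1.
Qed.

(** [u / phi u] is half the derivative of [Psi ^+ 2] at [p = Phi u], so this
    monotonicity is the convexity of [Psi ^+ 2]. *)
Let divgauss_le (u v : R) : u <= v -> u / phi u <= v / phi v.
Proof.
move=> uv; have gu := gauss_gt0 u; have gv := gauss_gt0 v.
rewrite ler_pdivrMr// mulrAC ler_pdivlMr//.
have [u0|u0] := leP 0 u.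
  by rewrite ler_pM ?(ltW gv)// gauss_le// !ger0_norm//; lra.
have [v0|v0] := leP 0 v.
  by apply: (@le_trans _ _ 0); nra.
have : phi u <= phi v by apply: gauss_le; rewrite !ltr0_norm//; lra.
by nra.
Qed.

(** With [a] and [b] the two square roots, the hypotheses give
    [((a + b)^2 - 4 i^2) ((a - b)^2 - 4 i^2) <= 0]; since [|a - b| <= a + b], the
    first factor is nonnegative. *)
Let two_point_algebra (i gp gm s : R) : 0 <= i -> 0 <= gp -> 0 <= gm ->
  2 * i ^+ 2 + s <= gp + gm -> (gp - gm) ^+ 2 <= 8 * i ^+ 2 * s ->
  2 * i <= Num.sqrt gp + Num.sqrt gm.
Proof.
move=> i0 gp0 gm0 S D.
have a0 := sqrtr_ge0 gp; have b0 := sqrtr_ge0 gm.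
move: S D; rewrite -{1 2}(sqr_sqrtr gp0) -{1 2}(sqr_sqrtr gm0).
set a := Num.sqrt gp in a0 *; set b := Num.sqrt gm in b0 *.
move=> S D; rewrite leNgt; apply/negP => lt.
have prod : ((a + b) ^+ 2 - 4 * i ^+ 2) * ((a - b) ^+ 2 - 4 * i ^+ 2) <= 0.
  have -> : ((a + b) ^+ 2 - 4 * i ^+ 2) * ((a - b) ^+ 2 - 4 * i ^+ 2) =
    (a ^+ 2 - b ^+ 2) ^+ 2 - 8 * i ^+ 2 * (a ^+ 2 + b ^+ 2 - 2 * i ^+ 2) by ring.
  rewrite subr_le0 (le_trans D)// ler_wpM2l ?mulr_ge0 ?sqr_ge0//.
  by lra.
have sum_lt : (a + b) ^+ 2 - 4 * i ^+ 2 < 0.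
  have -> : (a + b) ^+ 2 - 4 * i ^+ 2 = - ((2 * i - (a + b)) * (2 * i + (a + b))) by ring.
  by rewrite oppr_lt0 mulr_gt0//; lra.
have diff_le : (a - b) ^+ 2 <= (a + b) ^+ 2.
  have dE : (a + b) ^+ 2 - (a - b) ^+ 2 = 4 * a * b by ring.
  by rewrite -subr_ge0 dE !mulr_ge0.
by move: prod; rewrite leNgt nmulr_rgt0//; lra.
Qed.

Let is_derive_lin (f g h : R -> R) (a b e t df dg dh d : R) :
  is_derive t (1 : R) f df -> is_derive t (1 : R) g dg -> is_derive t (1 : R) h dh ->
  a * df + b * dg + e * dh = d ->
  is_derive t (1 : R) (fun s => a * f s + b * g s + e * h s) d.
Proof.
move=> Df Dg Dh <-.
exact: (is_deriveD (is_deriveD (is_deriveZ a Df) (is_deriveZ b Dg)) (is_deriveZ e Dh)).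
Qed.

Section fixed_centre.
Variables (c x : R).
Hypotheses (x0 : 0 <= x) (cx0 : 0 < c - x) (cx1 : c + x < 1).

Let mem_p (t : R) : 0 <= t <= x -> 0 < c + t < 1.
Proof. by have := (x0, cx0, cx1) => -[[] ? ? ?] /andP[t0 tx]; apply/andP; split; lra. Qed.
Let mem_m (t : R) : 0 <= t <= x -> 0 < c - t < 1.
Proof. by have := (x0, cx0, cx1) => -[[] ? ? ?] /andP[t0 tx]; apply/andP; split; lra. Qed.

Let sum_sqrPsi (t : R) : 0 <= t <= x ->
  2 * Psi c ^+ 2 <= Psi (c + t) ^+ 2 + Psi (c - t) ^+ 2.
Proof.
move=> /andP[t0 tx].
pose k (s : R) := Psi (c + s) ^+ 2 + Psi (c - s) ^+ 2.
pose dk (s : R) := 2 * (Psi (c + s) / I (c + s)) - 2 * (Psi (c - s) / I (c - s)).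
suff : k 0 <= k t by rewrite /k addr0 subr0; lra.
apply: (@le_of_derive_ge0 R k dk 0 t t0) => s /andP[s0 st].
  have sx : 0 <= s <= x by rewrite s0 (le_trans st).
  have D1 := is_derive_shiftr _ c s _ (is_derive_sqrPsi _ (mem_p _ sx)).
  have D2 := is_derive_shiftl _ c s _ (is_derive_sqrPsi _ (mem_m _ sx)).
  exact: is_deriveD.
have sx : 0 <= s <= x by rewrite s0 (le_trans st).
suff : Psi (c - s) / I (c - s) <= Psi (c + s) / I (c + s) by rewrite /dk; lra.
apply: divgauss_le; rewrite le_Psi ?mem_p// PsiK ?mem_m//; lra.
Qed.

(** By [I'' = - 2 pi / I], the second derivative of
    [I (c + t) ^+ 2 + 2 pi t ^+ 2] is [8 pi ^+ 2 Psi (c + t) ^+ 2].  The sum over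
    [t] and [- t] is bounded below by convexity of [Psi ^+ 2], and is then
    integrated twice from [t = 0]. *)
Let sum_sqrI : 2 * I c ^+ 2 + 8 * pi ^+ 2 * Psi c ^+ 2 * x ^+ 2 <=
  I (c + x) ^+ 2 + I (c - x) ^+ 2 + 4 * pi * x ^+ 2.
Proof.
pose H1 (t : R) := - (4 * pi) * J (c + t) + 4 * pi * J (c - t)
   + (8 * pi - 16 * pi ^+ 2 * Psi c ^+ 2) * t.
pose dH1 (t : R) := - (4 * pi) * (1 - 2 * pi * Psi (c + t) ^+ 2)
   + (4 * pi) * - (1 - 2 * pi * Psi (c - t) ^+ 2)
   + (8 * pi - 16 * pi ^+ 2 * Psi c ^+ 2).
have H1_ge0 (t : R) : 0 <= t <= x -> 0 <= H1 t.
  move=> /andP[t0 tx].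
  have <- : H1 0 = 0 by rewrite /H1 addr0 subr0; ring.
  apply: (@le_of_derive_ge0 R H1 dH1 0 t t0) => s /andP[s0 st].
    have sx : 0 <= s <= x by rewrite s0 (le_trans st).
    have D1 := is_derive_shiftr _ c s _ (is_derive_J _ (mem_p _ sx)).
    have D2 := is_derive_shiftl _ c s _ (is_derive_J _ (mem_m _ sx)).
    apply: (is_derive_lin _ _ id _ _ _ _ _ _ 1 _ D1 D2).
    by rewrite /dH1 mulr1.
  have sx : 0 <= s <= x by rewrite s0 (le_trans st).
  have := sum_sqrPsi s sx; have p2 : 0 < (pi : R) ^+ 2 by rewrite exprn_gt0 ?pi_gt0.
  move=> kk.
  have -> : dH1 s = 8 * (pi ^+ 2 * (Psi (c + s) ^+ 2 + Psi (c - s) ^+ 2 - 2 * Psi c ^+ 2)).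
    by rewrite /dH1; ring.
  by rewrite pmulr_rge0// pmulr_rge0// subr_ge0.
pose H (t : R) := 1 * I (c + t) ^+ 2 + 1 * I (c - t) ^+ 2 + (4 * pi - 8 * pi ^+ 2 * Psi c ^+ 2) * t ^+ 2.
suff : H 0 <= H x by rewrite /H addr0 subr0; lra.
apply: (@le_of_derive_ge0 R H H1 0 x x0) => t tx; last exact: H1_ge0.
have D1 := is_derive_shiftr _ c t _ (is_derive_sqrI _ (mem_p _ tx)).
have D2 := is_derive_shiftl _ c t _ (is_derive_sqrI _ (mem_m _ tx)).
have D3 : is_derive t (1 : R) (fun s => s ^+ 2) (2 * t).
  by apply: is_derive_eq; rewrite /GRing.scale/=; ring.
apply: (is_derive_lin _ _ (fun s => s ^+ 2) _ _ _ _ _ _ _ _ D1 D2 D3).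
by rewrite /H1; ring.
Qed.

(** To the left of the median, [Psi (c + t) ^+ 2 <= Psi (c - t) ^+ 2], so
    [I (c + t) ^+ 2 - I (c - t) ^+ 2] is concave in [t] and lies below its
    tangent at 0. *)
Let diff_sqrI : Psi c <= 0 ->
  0 <= I (c + x) ^+ 2 - I (c - x) ^+ 2 <= - (8 * pi * J c) * x.
Proof.
move=> Pc0; have := (x0, cx0, cx1) => -[[] h0 h1 h2].
have c01 : 0 < c < 1 by apply/andP; split; lra.
have Psi_abs (t : R) : 0 <= t <= x -> `|Psi (c + t)| <= `|Psi (c - t)|.
  move=> tx; have /andP[t0 t1] := tx; have /andP[m0 m1] := mem_m _ tx.
  have Pm : Psi (c - t) <= Psi c by rewrite Psi_le ?mem_m// PsiK//; lra.
  have Pmp : Psi (c - t) <= Psi (c + t).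
    by rewrite Psi_le ?mem_m// PsiK ?mem_p//; lra.
  rewrite (ler0_norm (le_trans Pm Pc0)) ler_norml opprK Pmp/=.
  rewrite -PsiN ?mem_m// Psi_le ?mem_p// PsiK; last by apply/andP; split; lra.
  have : c <= Phi 0 by rewrite -Psi_le.
  by have := PhiN (0 : R); rewrite oppr0; lra.
apply/andP; split.
  have xx : 0 <= x <= x by rewrite x0 lexx.
  rewrite subr_ge0 lerXn2r ?nnegrE ?(ltW (gauss_profile_gt0 _))//.
  by apply: gauss_le; exact: Psi_abs.
pose E (t : R) := 1 * J (c + t) + 1 * J (c - t) + - 2 * J c.
pose dE (t : R) := (1 - 2 * pi * Psi (c + t) ^+ 2) + - (1 - 2 * pi * Psi (c - t) ^+ 2).
have E_ge0 (t : R) : 0 <= t <= x -> 0 <= E t.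
  move=> /andP[t0 tx].
  have <- : E 0 = 0 by rewrite /E addr0 subr0; ring.
  apply: (@le_of_derive_ge0 R E dE 0 t t0) => s /andP[s0 st].
    have sx : 0 <= s <= x by rewrite s0 (le_trans st).
    have D1 := is_derive_shiftr _ c s _ (is_derive_J _ (mem_p _ sx)).
    have D2 := is_derive_shiftl _ c s _ (is_derive_J _ (mem_m _ sx)).
    apply: (is_derive_lin _ _ (cst (J c)) _ _ _ _ _ _ 0 _ D1 D2).
    by rewrite /dE; ring.
  have sx : 0 <= s <= x by rewrite s0 (le_trans st).
  have -> : dE s = 2 * pi * (Psi (c - s) ^+ 2 - Psi (c + s) ^+ 2) by rewrite /dE; ring.
  rewrite !mulr_ge0 ?pi_ge0// subr_ge0.
  by rewrite -[leLHS]real_normK ?num_real// -[leRHS]real_normK ?num_real// lerXn2r ?nnegrE ?Psi_abs.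
pose D (t : R) := - 1 * I (c + t) ^+ 2 + 1 * I (c - t) ^+ 2 + - (8 * pi * J c) * t.
suff : D 0 <= D x by rewrite /D addr0 subr0; lra.
apply: (@le_of_derive_ge0 R D (fun t => 4 * pi * E t) 0 x x0) => t tx; last first.
  by rewrite !mulr_ge0 ?pi_ge0 ?E_ge0.
have D1 := is_derive_shiftr _ c t _ (is_derive_sqrI _ (mem_p _ tx)).
have D2 := is_derive_shiftl _ c t _ (is_derive_sqrI _ (mem_m _ tx)).
apply: (is_derive_lin _ _ id _ _ _ _ _ _ 1 _ D1 D2).
by rewrite /E; ring.
Qed.

Lemma two_point_centre_le0 : Psi c <= 0 ->
  2 * I c <= Num.sqrt (I (c + x) ^+ 2 + 2 * pi * x ^+ 2)
    + Num.sqrt (I (c - x) ^+ 2 + 2 * pi * x ^+ 2).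
Proof.
move=> /diff_sqrI /andP[d0 dle].
have q0 : 0 <= 2 * pi * x ^+ 2 by rewrite !mulr_ge0 ?pi_ge0 ?sqr_ge0.
apply: (two_point_algebra _ _ _ (8 * pi ^+ 2 * Psi c ^+ 2 * x ^+ 2)).
- exact/ltW/gauss_profile_gt0.
- by rewrite addr_ge0 ?sqr_ge0.
- by rewrite addr_ge0 ?sqr_ge0.
- by have := sum_sqrI; lra.
have -> : 8 * I c ^+ 2 * (8 * pi ^+ 2 * Psi c ^+ 2 * x ^+ 2) =
  (- (8 * pi * J c) * x) ^+ 2 by rewrite /J; ring.
rewrite lerXn2r ?nnegrE//; first by lra.
- by apply: le_trans dle.
- by lra.
Qed.

End fixed_centre.

Lemma gauss_profile_onem (p : R) : 0 < p < 1 -> I (1 - p) = I p.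
Proof. by move=> p01; rewrite /gauss_profile PsiN// gaussN. Qed.

Let onem_itv (p : R) : 0 < p < 1 -> 0 < 1 - p < 1.
Proof. by move=> /andP[? ?]; apply/andP; split; lra. Qed.

(** Exchanging [a] and [b], and replacing both by their complements to 1,
    reduces to [b <= a] with midpoint at most 1/2. *)
Lemma bobkov_two_point (a b : R) : 0 < a < 1 -> 0 < b < 1 ->
  I ((a + b) / 2) <= (Num.sqrt (I a ^+ 2 + 2 * pi * ((a - b) / 2) ^+ 2)
    + Num.sqrt (I b ^+ 2 + 2 * pi * ((a - b) / 2) ^+ 2)) / 2.
Proof.
wlog ba : a b / b <= a.
  move=> H a01 b01; have [/H//|/ltW /H Hba] := leP b a; first exact.
  by rewrite (addrC a) -(opprB b a) mulNr sqrrN (addrC (Num.sqrt _)); exact: Hba.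
wlog c0 : a b ba / Psi ((a + b) / 2) <= 0.
  move=> H a01 b01; have [c0|c0] := leP (Psi ((a + b) / 2)) 0; first exact: H.
  have c01 : 0 < (a + b) / 2 < 1.
    by move: a01 b01 => /andP[? ?] /andP[? ?]; apply/andP; split; lra.
  have cE : (1 - b + (1 - a)) / 2 = 1 - (a + b) / 2 by field.
  have := H (1 - b) (1 - a); rewrite cE PsiN// !gauss_profile_onem//.
  have -> : 1 - b - (1 - a) = a - b by ring.
  by rewrite (addrC (Num.sqrt _)); apply; rewrite ?onem_itv//; lra.
move=> /andP[a0 a1] /andP[b0 b1].
have x0 : 0 <= (a - b) / 2 by lra.
have ca : (a + b) / 2 + (a - b) / 2 = a by field.
have cb : (a + b) / 2 - (a - b) / 2 = b by field.
have := two_point_centre_le0 ((a + b) / 2) ((a - b) / 2) x0; rewrite ca cb => /(_ b0 a1 c0).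
by rewrite ler_pdivlMr// mulrC.
Qed.

End two_point.

(** * Bobkov's inequality on the discrete cube *)

Section coin_mean.
Context {R : realType}.
Notation I := (@gauss_profile R).
Implicit Types g h : seq bool -> R.

(** Only the values of [g] on sequences of length [n] matter.  Plain sequences
    rather than tuples keep the recursion on the first coin definitional. *)
Fixpoint coin_mean (n : nat) (g : seq bool -> R) : R :=
  if n is m.+1 then
    (coin_mean m (fun s => g (true :: s)) + coin_mean m (fun s => g (false :: s))) / 2
  else g [::].

Lemma coin_mean_le n g h : (forall s, size s = n -> g s <= h s) ->
  coin_mean n g <= coin_mean n h.
Proof.
elim: n g h => [|n IHn] g h gh /=; first exact: gh.
by rewrite ler_pM2r ?invr_gt0// lerD// IHn// => s sn; apply: gh; rewrite /= sn.
Qed.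

Lemma eq_coin_mean n g h : (forall s, size s = n -> g s = h s) ->
  coin_mean n g = coin_mean n h.
Proof. by move=> gh; apply/le_anti; rewrite !coin_mean_le// => s /gh ->. Qed.

Lemma coin_mean_cst n (c : R) : coin_mean n (fun=> c) = c.
Proof. by elim: n => //= n ->; field. Qed.

Lemma coin_meanD n g h :
  coin_mean n (fun s => g s + h s) = coin_mean n g + coin_mean n h.
Proof. by elim: n g h => //= n IHn g h; rewrite !IHn; field. Qed.

Lemma coin_meanZ n (c : R) g : coin_mean n (fun s => c * g s) = c * coin_mean n g.
Proof. by elim: n g => //= n IHn g; rewrite !IHn; field. Qed.

Lemma coin_mean_sum n (T : finType) (P : pred T) (G : T -> seq bool -> R) :
  coin_mean n (fun s => \sum_(t | P t) G t s) = \sum_(t | P t) coin_mean n (G t).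
Proof.
elim: n G => //= n IHn G.
by rewrite !IHn -big_split/= mulr_suml.
Qed.

Lemma coin_mean_gt n g (c : R) : (forall s, size s = n -> c < g s) -> c < coin_mean n g.
Proof.
elim: n g => [|n IHn] g cg /=; first exact: cg.
have Ht : c < coin_mean n (fun s => g (true :: s)).
  by apply: IHn => s sn; apply: cg; rewrite /= sn.
have Hf : c < coin_mean n (fun s => g (false :: s)).
  by apply: IHn => s sn; apply: cg; rewrite /= sn.
by lra.
Qed.

Lemma coin_mean_itv n g : (forall s, size s = n -> 0 < g s < 1) -> 0 < coin_mean n g < 1.
Proof.
move=> g01; apply/andP; split; first by apply: coin_mean_gt => s /g01/andP[].
rewrite -ltrN2 -(mulN1r (coin_mean _ _)) -coin_meanZ.
apply: coin_mean_gt => s /g01/andP[_ ?].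
by rewrite mulN1r ltrN2.
Qed.

Lemma sqrt_addr_sqr_le (a b c d : R) :
  Num.sqrt ((a + c) ^+ 2 + (b + d) ^+ 2) <=
  Num.sqrt (a ^+ 2 + b ^+ 2) + Num.sqrt (c ^+ 2 + d ^+ 2).
Proof.
have u0 := sqrtr_ge0 (a ^+ 2 + b ^+ 2); have v0 := sqrtr_ge0 (c ^+ 2 + d ^+ 2).
have uE := sqr_sqrtr (addr_ge0 (sqr_ge0 a) (sqr_ge0 b)).
have vE := sqr_sqrtr (addr_ge0 (sqr_ge0 c) (sqr_ge0 d)).
set u := Num.sqrt (a ^+ 2 + b ^+ 2) in u0 uE *.
set v := Num.sqrt (c ^+ 2 + d ^+ 2) in v0 vE *.
have uv0 : 0 <= u * v by rewrite mulr_ge0.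
have cs : a * c + b * d <= u * v.
  have [s0|s0] := leP (a * c + b * d) 0; first by lra.
  rewrite -(@ler_pXn2r _ 2) ?nnegrE// ?(ltW s0)// exprMn uE vE -subr_ge0.
  have -> : (a ^+ 2 + b ^+ 2) * (c ^+ 2 + d ^+ 2) - (a * c + b * d) ^+ 2
    = (a * d - b * c) ^+ 2 by ring.
  exact: sqr_ge0.
rewrite -(ger0_norm (addr_ge0 u0 v0)) -sqrtr_sqr ler_wsqrtr//.
have -> : (u + v) ^+ 2 = u ^+ 2 + v ^+ 2 + 2 * (u * v) by ring.
rewrite uE vE; have -> : (a + c) ^+ 2 + (b + d) ^+ 2 =
  a ^+ 2 + b ^+ 2 + (c ^+ 2 + d ^+ 2) + 2 * (a * c + b * d) by ring.
by lra.
Qed.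

(** The triangle inequality for the Euclidean norm of the plane. *)
Lemma coin_mean_norm n g h :
  Num.sqrt (coin_mean n g ^+ 2 + coin_mean n h ^+ 2) <=
  coin_mean n (fun s => Num.sqrt (g s ^+ 2 + h s ^+ 2)).
Proof.
elim: n g h => //= n IHn g h.
have /le_trans := sqrt_addr_sqr_le
  (coin_mean n (fun s => g (true :: s)) / 2) (coin_mean n (fun s => h (true :: s)) / 2)
  (coin_mean n (fun s => g (false :: s)) / 2) (coin_mean n (fun s => h (false :: s)) / 2).
rewrite -!mulrDl; apply.
have half (x y : R) : Num.sqrt ((x / 2) ^+ 2 + (y / 2) ^+ 2) = Num.sqrt (x ^+ 2 + y ^+ 2) / 2.
  rewrite !exprMn -mulrDl sqrtrM ?addr_ge0 ?sqr_ge0// sqrtr_sqr ger0_norm//.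
by rewrite !half -mulrDl ler_pM2r ?invr_gt0// lerD.
Qed.

Definition flip (i : nat) (s : seq bool) : seq bool :=
  set_nth false s i (~~ nth false s i).

Definition discrete_grad2 (n : nat) (g : seq bool -> R) (s : seq bool) : R :=
  \sum_(i < n) ((g (flip i s) - g s) / 2) ^+ 2.

Lemma discrete_grad2_ge0 n g s : 0 <= discrete_grad2 n g s.
Proof. by apply: sumr_ge0 => i _; exact: sqr_ge0. Qed.

Lemma discrete_grad2_cons n g b s : discrete_grad2 n.+1 g (b :: s) =
  ((g (true :: s) - g (false :: s)) / 2) ^+ 2 +
    discrete_grad2 n (fun s' => g (b :: s')) s.
Proof.
rewrite /discrete_grad2 big_ord_recl; congr (_ + _).
by case: b => //=; rewrite -opprB mulNr sqrrN.
Qed.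

(** Conditioning on the first coin, the two-point inequality bounds the profile
    of the mean by the two conditional means and their difference.  The induction
    hypothesis bounds the profile of each conditional mean, and the difference
    of conditional means is a mean of increments along the first coin; both
    are then brought under one mean by [coin_mean_norm]. *)
Theorem bobkov_cube n g : (forall s, size s = n -> 0 < g s < 1) ->
  I (coin_mean n g) <=
  coin_mean n (fun s => Num.sqrt (I (g s) ^+ 2 + 2 * pi * discrete_grad2 n g s)).
Proof.
elim: n g => [|n IHn] g g01 /=.
  by rewrite /discrete_grad2 big_ord0 mulr0 addr0 sqrtr_sqr ler_norm.
have g01b b s : size s = n -> 0 < g (b :: s) < 1.
  by move=> sn; apply: g01; rewrite /= sn.
pose G b s := g (b :: s); pose a b := coin_mean n (G b).
have a01 b : 0 < a b < 1 by apply: coin_mean_itv => s; exact: g01b.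
have := bobkov_two_point _ _ (a01 true) (a01 false).
move=> /le_trans; apply; rewrite ler_pM2r ?invr_gt0//.
have q0 : 0 <= 2 * pi :> R by rewrite mulr_ge0 ?pi_ge0.
suff step b : Num.sqrt (I (a b) ^+ 2 + 2 * pi * ((a true - a false) / 2) ^+ 2) <=
    coin_mean n (fun s => Num.sqrt (I (g (b :: s)) ^+ 2 +
      2 * pi * discrete_grad2 n.+1 g (b :: s))) by exact: lerD.
pose K s := Num.sqrt (I (G b s) ^+ 2 + 2 * pi * discrete_grad2 n (G b) s).
pose L s := Num.sqrt (2 * pi) / 2 * (G true s + -1 * G false s).
have LE : coin_mean n L = Num.sqrt (2 * pi) / 2 * (a true - a false).
  by rewrite coin_meanZ coin_meanD coin_meanZ mulN1r.
have -> : 2 * pi * ((a true - a false) / 2) ^+ 2 = coin_mean n L ^+ 2.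
  by rewrite LE -{1}(sqr_sqrtr q0); ring.
apply: (@le_trans _ _ (Num.sqrt (coin_mean n K ^+ 2 + coin_mean n L ^+ 2))).
  rewrite ler_wsqrtr// lerD2r lerXn2r ?nnegrE ?(ltW (gauss_profile_gt0 _))//.
    by apply: le_trans (IHn _ (g01b b)); exact/ltW/gauss_profile_gt0.
  exact: IHn (g01b b).
apply: le_trans (coin_mean_norm _ _ _) _; apply: coin_mean_le => s _.
rewrite ler_wsqrtr// sqr_sqrtr ?addr_ge0 ?sqr_ge0 ?mulr_ge0 ?pi_ge0 ?discrete_grad2_ge0//.
have LsE : L s ^+ 2 = 2 * pi * ((G true s - G false s) / 2) ^+ 2.
  by rewrite /L -{2}(sqr_sqrtr q0); ring.
by rewrite LsE discrete_grad2_cons -addrA -mulrDr (addrC (discrete_grad2 _ _ _)).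
Qed.

End coin_mean.

(** * Wallis' bound for the central binomial probability *)

Section wallis.
Context {R : realType}.

Definition central_atom (m : nat) : R := 'C(m.*2, m)%:R / 2 ^+ m.*2.

Lemma central_atom_gt0 m : 0 < central_atom m.
Proof. by rewrite divr_gt0 ?exprn_gt0// ltr0n bin_gt0 -addnn leq_addr. Qed.

Lemma central_atomS m :
  (m.*2.+2)%:R * central_atom m.+1 = (m.*2.+1)%:R * central_atom m.
Proof.
have binS : (m.+1 * 'C(m.*2.+2, m.+1) = 2 * (m.*2.+1 * 'C(m.*2, m)))%N.
  have symm : 'C(m.*2.+1, m) = 'C(m.*2.+1, m.+1).
    by rewrite -(@bin_sub m.*2.+1 m); [congr binomial; lia|lia].
  rewrite -(mul_bin_diag m.*2.+2 m) /= symm.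
  by rewrite (mul_bin_diag m.*2.+1 m); lia.
have binSR : m.+1%:R * ('C(m.*2.+2, m.+1))%:R = 2 * (m.*2.+1%:R * ('C(m.*2, m))%:R) :> R.
  by rewrite -!natrM binS.
rewrite /central_atom doubleS !exprS.
have e0 : (2 : R) ^+ m.*2 != 0 by rewrite expf_neq0.
have -> : m.*2.+2%:R = 2 * m.+1%:R :> R by rewrite -natrM; congr (_%:R); lia.
have -> : 2 * m.+1%:R * ('C(m.*2.+2, m.+1)%:R / (2 * (2 * 2 ^+ m.*2))) =
  (m.+1%:R * ('C(m.*2.+2, m.+1))%:R) / (2 * 2 ^+ m.*2) :> R by field.
by rewrite binSR; field.
Qed.

(** Primitives of [sin ^+ m.*2] and [sin ^+ m.*2.+1] that vanish at 0, by the
    usual reduction formula.  Working with primitives makes integrals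
    superfluous: only derivatives and the values at the end points are used. *)
Fixpoint sin_even_primitive (m : nat) (x : R) : R :=
  if m is k.+1 then
    k.*2.+1%:R / k.*2.+2%:R * sin_even_primitive k x
      - k.*2.+2%:R^-1 * (cos x * sin x ^+ k.*2.+1)
  else x.

Fixpoint sin_odd_primitive (m : nat) (x : R) : R :=
  if m is k.+1 then
    k.*2.+2%:R / k.*2.+3%:R * sin_odd_primitive k x
      - k.*2.+3%:R^-1 * (cos x * sin x ^+ k.*2.+2)
  else 1 - cos x.

Let is_derive_step (F : R -> R) (n : nat) (x : R) :
  is_derive x (1 : R) F (sin x ^+ n) ->
  is_derive x (1 : R)
    (fun y => n.+1%:R / n.+2%:R * F y - n.+2%:R^-1 * (cos y * sin y ^+ n.+1))
    (sin x ^+ n.+2).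
Proof.
move=> DF; have n2 : n.+2%:R != 0 :> R by rewrite pnatr_eq0.
have Dc := is_derive_cos x; have Ds := is_derive_sin x.
have DP : is_derive x (1 : R) (fun y => cos y * sin y ^+ n.+1)
    (cos x * (n.+1%:R * sin x ^+ n * cos x) + sin x ^+ n.+1 * - sin x).
  have DX : is_derive x (1 : R) (fun y => sin y ^+ n.+1) (n.+1%:R * sin x ^+ n * cos x).
    rewrite (_ : (fun y => sin y ^+ n.+1) = sin ^+ n.+1); first exact: (is_deriveX n.+1 Ds).
    by apply/funext => y; rewrite exprfctE.
  exact: (is_deriveM Dc DX).
pose a : R := n.+1%:R / n.+2%:R; pose b : R := n.+2%:R^-1.
have D : is_derive x (1 : R) (fun y => a * F y - b * (cos y * sin y ^+ n.+1))
    (a * sin x ^+ n - b * (cos x * (n.+1%:R * sin x ^+ n * cos x) + sin x ^+ n.+1 * - sin x)).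
  exact: (is_deriveB (is_deriveZ a DF) (is_deriveZ b DP)).
rewrite (_ : sin x ^+ n.+2 = a * sin x ^+ n -
  b * (cos x * (n.+1%:R * sin x ^+ n * cos x) + sin x ^+ n.+1 * - sin x)) //.
rewrite /a /b !exprS.
have c2 : cos x ^+ 2 = 1 - sin x ^+ 2 by have := cos2Dsin2 x; lra.
have -> : n.+2%:R = n.+1%:R + 1 :> R by rewrite -[in LHS]addn1 natrD.
have n2' : n.+1%:R + 1 != 0 :> R by rewrite -natr1 in n2.
have -> : cos x * (n.+1%:R * (sin x ^+ n) * cos x) = n.+1%:R * sin x ^+ n * cos x ^+ 2 by ring.
by rewrite c2; field.
Qed.

Lemma is_derive_sin_even_primitive m (x : R) :
  is_derive x (1 : R) (sin_even_primitive m) (sin x ^+ m.*2).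
Proof.
elim: m => [|m IHm] /=; first by rewrite expr0; exact: is_derive_id.
exact: is_derive_step.
Qed.

Lemma is_derive_sin_odd_primitive m (x : R) :
  is_derive x (1 : R) (sin_odd_primitive m) (sin x ^+ m.*2.+1).
Proof.
elim: m => [|m IHm] /=; last exact: is_derive_step.
rewrite expr1; have Dc := is_derive_cos x.
rewrite (_ : sin x = 0 - - sin x); last by rewrite sub0r opprK.
exact: (is_deriveB (is_derive_cst (1 : R) x (1 : R)) Dc).
Qed.

Lemma sin_even_primitive_pihalf m : sin_even_primitive m (pi / 2) = pi / 2 * central_atom m.
Proof.
elim: m => [|m IHm] /=; first by rewrite /central_atom bin0 divr1 mulr1.
rewrite cos_pihalf mul0r mulr0 subr0 IHm.
have n2 : m.*2.+2%:R != 0 :> R by rewrite pnatr_eq0.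
apply: (mulfI n2); rewrite (mulrCA m.*2.+2%:R (pi / 2)) central_atomS.
by field.
Qed.

Lemma sin_odd_primitive_pihalf m :
  m.*2.+2%:R * central_atom m.+1 * sin_odd_primitive m (pi / 2) = 1.
Proof.
elim: m => [|m IHm].
  by rewrite central_atomS /= cos_pihalf subr0 /central_atom bin0 expr0 divr1 !mulr1.
rewrite central_atomS /= cos_pihalf mul0r mulr0 subr0.
have n3 : m.*2.+3%:R != 0 :> R by rewrite pnatr_eq0.
by rewrite doubleS -[RHS]IHm; field.
Qed.

(** Wallis: [sin ^+ m.+1.*2 <= sin ^+ m.*2.+1] on the first quadrant, so the
    integrals compare; their product is a multiple of the reciprocal of [m.+1],
    and the even one is [pi / 2 * central_atom m.+1]. *)
Lemma central_atom_sqr_le m : (0 < m)%N -> pi * m%:R * central_atom m ^+ 2 <= 1.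
Proof.
case: m => // m _; have p2 := pi_gt0 R.
have at0 k : sin_even_primitive k 0 = 0 /\ sin_odd_primitive k 0 = 0.
  elim: k => [|k [IHe IHo]] /=; first by rewrite cos0 subrr.
  by rewrite IHe IHo sin0 !exprS !mul0r !mulr0 subrr.
have mono : sin_odd_primitive m 0 - sin_even_primitive m.+1 0 <=
    sin_odd_primitive m (pi / 2) - sin_even_primitive m.+1 (pi / 2).
  apply: (@le_of_derive_ge0 R (fun x => sin_odd_primitive m x - sin_even_primitive m.+1 x)
    (fun x => sin x ^+ m.*2.+1 - sin x ^+ m.+1.*2)) => [|x _|x /andP[x0 xp]].
  - by lra.
  - exact: is_deriveB (is_derive_sin_odd_primitive m x) (is_derive_sin_even_primitive m.+1 x).
  - have s0 : 0 <= sin x by apply: sin_ge0_pi; lra.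
    by rewrite subr_ge0 doubleS exprS ler_piMl ?exprn_ge0// sin_le1.
move: mono; rewrite (at0 m).2 (at0 m.+1).1 subrr subr_ge0 sin_even_primitive_pihalf.
move=> le; rewrite -[leRHS](sin_odd_primitive_pihalf m).
have w0 := central_atom_gt0 m.+1; have m0 : 0 < m.+1%:R :> R by rewrite ltr0n.
have -> : m.*2.+2%:R = 2 * m.+1%:R :> R by rewrite -natrM; congr (_%:R); lia.
have -> : pi * m.+1%:R * central_atom m.+1 ^+ 2 =
  2 * m.+1%:R * central_atom m.+1 * (pi / 2 * central_atom m.+1) by field.
by rewrite ler_pM2l // pmulr_rgt0 // pmulr_rgt0.
Qed.

Lemma bin_le_central m k : ('C(m.*2, k) <= 'C(m.*2, m))%N.
Proof.
have up j : (j < m)%N -> ('C(m.*2, j) <= 'C(m.*2, j.+1))%N.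
  move=> jm; rewrite -(leq_pmul2l (ltn0Sn j)) mul_bin_left leq_mul2r.
  by apply/orP; right; lia.
have le_m j : (j <= m)%N -> ('C(m.*2, j) <= 'C(m.*2, m))%N.
  move=> jm; rewrite -(subKn jm); elim: (m - j)%N (leq_subr j m) => [|i IHi] im.
    by rewrite subn0.
  apply: leq_trans (IHi _); last by lia.
  by have := up (m - i.+1)%N; rewrite subnSK//; apply; lia.
have [km|mk] := leqP k m; first exact: le_m.
have [k2|k2] := leqP k m.*2; last by rewrite (bin_small k2).
by rewrite -(bin_sub k2); apply: le_m; lia.
Qed.

Lemma binomial_atom_le m k : 'C(m.*2, k)%:R / 2 ^+ m.*2 <= central_atom m :> R.
Proof. by rewrite ler_pM2r ?invr_gt0 ?exprn_gt0// ler_nat bin_le_central. Qed.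

End wallis.

(** * Cutting the cube into cells of binomial volume *)

Section block_counts.
Context {R : realType}.

Definition block_count (N j : nat) (s : seq bool) : nat :=
  \sum_(r < N) nth false s (j * N + r).

Lemma block_count_le N j s : (block_count N j s <= N)%N.
Proof.
apply: (@leq_trans (\sum_(r < N) 1)%N); last by rewrite sum1_card card_ord.
by apply: leq_sum => r _; case: nth.
Qed.

Lemma block_count_flip_neq N i j s : (0 < N)%N -> j != (i %/ N)%N ->
  block_count N j (flip i s) = block_count N j s.
Proof.
move=> N0 ji; apply: eq_bigr => r _; rewrite nth_set_nth /=; case: eqP => // e.
by move: ji; rewrite -e divnMDl// divn_small// addn0 eqxx.
Qed.

Lemma block_count_flip_eq N i s : (0 < N)%N ->
  block_count N (i %/ N) (flip i s) = (block_count N (i %/ N) s).+1 \/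
  block_count N (i %/ N) s = (block_count N (i %/ N) (flip i s)).+1.
Proof.
move=> N0; have iN : (i %% N < N)%N by rewrite ltn_pmod.
pose r0 := Ordinal iN; have r0E : (i %/ N * N + r0 = i)%N by rewrite -divn_eq.
have splitE t : block_count N (i %/ N) t =
    (nth false t i + \sum_(r < N | r != r0) nth false t (i %/ N * N + r))%N.
  by rewrite /block_count (bigD1 r0)//= r0E.
rewrite !splitE nth_set_nth /= eqxx.
rewrite (eq_bigr (fun r : 'I_N => nat_of_bool (nth false s (i %/ N * N + r)))).
  by case: (nth false s i); rewrite /=; [right|left]; rewrite ?add0n ?add1n.
move=> r rr0; rewrite nth_set_nth /=; case: eqP => // e.
by case/eqP: rr0; apply/val_inj => /=; rewrite -[in RHS]e modnMDl modn_small.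
Qed.

Lemma coin_mean_cat a b (g : seq bool -> R) :
  coin_mean (a + b) g = coin_mean a (fun s => coin_mean b (fun t => g (s ++ t))).
Proof. by elim: a g => //= a IHa g; rewrite !IHa. Qed.

Lemma coin_mean_head_count N k :
  coin_mean N (fun s => ((\sum_(r < N) nth false s r)%N == k)%:R) =
  'C(N, k)%:R / 2 ^+ N :> R.
Proof.
elim: N k => [|N IHN] k /=.
  by rewrite big_ord0 expr0 divr1; case: k.
rewrite (eq_coin_mean N _ (fun s => ((\sum_(r < N) nth false s r).+1%N == k)%:R)); last first.
  by move=> s _; rewrite big_ord_recl.
rewrite [X in _ + X](eq_coin_mean N _ (fun s => ((\sum_(r < N) nth false s r)%N == k)%:R)); last first.
  by move=> s _; rewrite big_ord_recl.
rewrite IHN exprS; have e0 : (2 : R) ^+ N != 0 by rewrite expf_neq0.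
case: k => [|k].
  rewrite (eq_coin_mean N _ (fun=> 0))// coin_mean_cst !bin0.
  by field.
rewrite (eq_coin_mean N _ (fun s => ((\sum_(r < N) nth false s r)%N == k)%:R))// IHN.
by rewrite binS natrD; field.
Qed.

(** The counts of heads in different blocks are independent binomial
    variables. *)
Lemma coin_mean_block_counts n N (k : 'I_n -> nat) :
  coin_mean (n * N) (fun s => \prod_(j < n) (block_count N j s == k j)%:R) =
  \prod_(j < n) ('C(N, k j)%:R / 2 ^+ N) :> R.
Proof.
elim: n k => [|n IHn] k.
  by rewrite big_ord0 /= big_ord0.
rewrite mulSn coin_mean_cat big_ord_recl -(IHn (fun j => k (lift ord0 j))).
rewrite -coin_mean_head_count mulrC -coin_meanZ.
apply: eq_coin_mean => s sN; rewrite mulrC -coin_meanZ.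
apply: eq_coin_mean => t _; rewrite big_ord_recl; congr (_ * _).
  congr ((_ == _)%:R); apply: eq_bigr => r _.
  by rewrite mul0n add0n nth_cat sN ltn_ord.
apply: eq_bigr => j _; congr ((_ == _)%:R); apply: eq_bigr => r _.
rewrite nth_cat sN lift0 mulSn -addnA ltnNge leq_addr /=.
by rewrite addKn.
Qed.

End block_counts.

Section binomial_grid.
Context {R : realType}.
Notation mu := (@lebesgue_measure R).

(** The probability of less than [k] heads, so that [k] heads correspond to the
    cell from [binomial_cdf N k] to [binomial_cdf N k.+1]. *)
Definition binomial_cdf (N k : nat) : R := \sum_(i < k) 'C(N, i)%:R / 2 ^+ N.

Lemma binomial_cdfS N k :
  binomial_cdf N k.+1 = binomial_cdf N k + 'C(N, k)%:R / 2 ^+ N.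
Proof. by rewrite /binomial_cdf big_ord_recr. Qed.

Lemma binomial_cdf0 N : binomial_cdf N 0 = 0.
Proof. exact: big_ord0. Qed.

Lemma binomial_cdf_full N : binomial_cdf N N.+1 = 1.
Proof.
have := Pascal 1 1 N.
rewrite /binomial_cdf -mulr_suml -natr_sum.
rewrite (eq_bigr (fun i : 'I_N.+1 => 'C(N, i))); last by move=> i _; rewrite !exp1n !muln1.
by move=> <-; rewrite natrX divff// expf_neq0.
Qed.

Lemma binomial_cdf_le N j k : (j <= k)%N -> binomial_cdf N j <= binomial_cdf N k.
Proof.
move=> jk; rewrite -(subnKC jk); elim: (k - j)%N => [|i IHi]; first by rewrite addn0.
by rewrite addnS binomial_cdfS (le_trans IHi)// lerDl divr_ge0 ?exprn_ge0.
Qed.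

Lemma binomial_cdf_itv N k : (k <= N.+1)%N -> 0 <= binomial_cdf N k <= 1.
Proof.
move=> kN; apply/andP; split.
  by rewrite -(binomial_cdf0 N) binomial_cdf_le.
by rewrite -(binomial_cdf_full N) binomial_cdf_le.
Qed.

Lemma binomial_cell (N : nat) (x : R) : 0 < x < 1 ->
  exists k : 'I_N.+1, binomial_cdf N k < x <= binomial_cdf N k.+1.
Proof.
move=> /andP[x0 x1].
have ex : exists k, x <= binomial_cdf N k.
  by exists N.+1; rewrite binomial_cdf_full ltW.
case: (ex_minnP ex) => -[|k] xk kmin; first by move: xk; rewrite binomial_cdf0 leNgt x0.
have kN : (k < N.+1)%N by apply: kmin; rewrite binomial_cdf_full ltW.
exists (Ordinal kN) => /=; rewrite xk andbT ltNge; apply/negP => /kmin.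
by rewrite ltnn.
Qed.

Lemma outer_measure_bigsetU_le (T : choiceType) (U : Type)
  (m : {outer_measure set U -> \bar R}) (r : seq T) (F : T -> set U) :
  (m (\big[setU/set0]_(t <- r) F t) <= \sum_(t <- r) m (F t))%E.
Proof.
elim: r => [|t r IHr]; first by rewrite !big_nil outer_measure0.
rewrite !big_cons; apply: le_trans (outer_measureU2 m _ _) _.
exact: leeD2l.
Qed.

Lemma volume_box n (F : 'I_n -> set (measurableTypeR R)) :
  (forall i, measurable (F i)) ->
  volume [set x : n.-tuple R | forall i, F i (tnth x i)] =
  (\prod_(i < n) mu (F i))%E.
Proof.
move=> mF; rewrite -(lebesgue_tuple_box mF) /volume /completed_measure_extension.
rewrite measurable_mu_extE//.
rewrite (_ : [set x | _] = \bigcap_(i in [set: 'I_n]) ((@tnth _ _ ^~ i) @^-1` F i)).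
  apply: fin_bigcap_measurable => // i _.
  by rewrite -[X in measurable X]setTI; exact: measurable_tnth.
by apply/seteqP; split=> t /= H i; [move=> _; exact: H | exact: (H i I)].
Qed.

Definition same_cell (n N : nat) (x : n.-tuple R) (s : seq bool) : Prop :=
  forall j : 'I_n, binomial_cdf N (block_count N j s) < tnth x j
    <= binomial_cdf N (block_count N j s).+1.

(** The cells that meet [A] cover it, and the coins pick each cell with a
    probability equal to its volume.  Only monotonicity and subadditivity of the
    outer measure are involved. *)
Lemma volume_le_coin_mean (n N : nat) (A : set (n.-tuple R)) : A `<=` @unit_cube R n ->
  (volume A <=
   (coin_mean (n * N) (fun s => `[< exists2 a, A a & same_cell n N a s >]%:R))%:E)%E.
Proof.
move=> Acube.
pose box (k : {ffun 'I_n -> 'I_N.+1}) : set (n.-tuple R) :=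
  [set x | forall j, binomial_cdf N (k j) < tnth x j <= binomial_cdf N (k j).+1].
pose K := [set k | `[< exists2 a, A a & box k a >]]%SET.
have AU : A `<=` \big[setU/set0]_(k in K) box k.
  move=> a Aa; rewrite -big_enum -bigcup_seq.
  have cell j : {k : 'I_N.+1 | binomial_cdf N k < tnth a j <= binomial_cdf N k.+1}.
    by apply/cid/binomial_cell/Acube.
  have ak : box [ffun j => projT1 (cell j)] a.
    by move=> j; rewrite ffunE; exact: projT2 (cell j).
  exists [ffun j => projT1 (cell j)] => //=.
  by rewrite mem_enum inE; apply/asboolP; exists a.
have mbox k : volume (box k) = (\prod_(j < n) ('C(N, k j)%:R / 2 ^+ N))%:E.
  rewrite /box (_ : [set x | _] = [set x : n.-tuple R | forall j,
    `]binomial_cdf N (k j), binomial_cdf N (k j).+1]%classic (tnth x j)]); last first.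
    by apply/seteqP; split=> x /= H j; have := H j; rewrite in_itv.
  rewrite (@volume_box n (fun j => `]binomial_cdf N (k j), binomial_cdf N (k j).+1]%classic))//.
  rewrite -prodEFin; apply: eq_bigr => j _.
  rewrite lebesgue_measure_itv/= lte_fin binomial_cdfS ltrDl.
  case: ifP => [_|]; first by rewrite -EFinB addrAC subrr add0r.
  move=> /negbT; rewrite -leNgt => le0; congr (_%:E); apply/le_anti.
  by rewrite le0 divr_ge0 ?exprn_ge0.
apply: (@le_trans _ _ (volume (\big[setU/set0]_(k in K) box k))).
  exact: le_outer_measure.
rewrite -big_enum; apply: le_trans (outer_measure_bigsetU_le _ _ _ _ _) _.
rewrite big_enum (eq_bigr (fun k : {ffun 'I_n -> 'I_N.+1} => (\prod_(j < n) ('C(N, k j)%:R / 2 ^+ N))%:E)); last first.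
  by move=> k _; exact: mbox.
rewrite sumEFin lee_fin.
under eq_bigr do rewrite -coin_mean_block_counts.
rewrite -coin_mean_sum; apply: coin_mean_le => s _.
have [c cE] : {c : {ffun 'I_n -> 'I_N.+1} | forall j, c j = block_count N j s :> nat}.
  have cN (j : 'I_n) : (block_count N j s < N.+1)%N by rewrite ltnS block_count_le.
  by exists [ffun j => Ordinal (cN j)] => j; rewrite ffunE.
have prodE (k : {ffun 'I_n -> 'I_N.+1}) :
    \prod_(j < n) (block_count N j s == k j)%:R = (k == c)%:R :> R.
  case: eqP => [->|kc]; first by rewrite big1// => j _; rewrite cE eqxx.
  have [j kj] : exists j, k j != c j.
    apply/existsP; rewrite -negb_forall; apply/negP => /forallP H; apply: kc.
    by apply/ffunP => j; apply/eqP; exact: H.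
  rewrite (bigD1 j)//= -cE (_ : _ == _ = false) ?mul0r//.
  by apply/negbTE; rewrite eq_sym (inj_eq val_inj).
under eq_bigr do rewrite prodE.
have [cK|cK] := boolP (c \in K).
  rewrite (bigD1 c)//= eqxx big1 ?addr0; last by move=> k /andP[_ /negbTE ->].
  move: cK; rewrite inE => /asboolP[a Aa ca].
  case: asboolP => [_|[]]; first exact: lexx.
  by exists a => // j; rewrite -cE.
by rewrite big1// => k kK; case: eqP => // kc; rewrite -kc kK in cK.
Qed.

End binomial_grid.

(** * Soft minimum of squared distances *)

Section soft_distance.
Context {R : realType} {n : nat}.
Implicit Types x y : 'I_n -> R.

Definition sqdist x y : R := \sum_(j < n) (x j - y j) ^+ 2.

Definition in_cube x : Prop := forall j, 0 <= x j <= 1.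

Lemma sqdist_ge0 x y : 0 <= sqdist x y.
Proof. by apply: sumr_ge0 => j _; exact: sqr_ge0. Qed.

Lemma sqdist_le_dim x y (r : R) : (forall j, `|x j - y j| <= r) ->
  sqdist x y <= n%:R * r ^+ 2.
Proof.
move=> xy; rewrite mulr_natl -[X in _ *+ X]card_ord -sumr_const; apply: ler_sum => j _.
have r0 : 0 <= r by apply: le_trans (xy j).
by rewrite -real_normK ?num_real// lerXn2r ?nnegrE.
Qed.

Lemma sqdist_perturb x y a (d : R) : in_cube x -> in_cube y -> in_cube a ->
  (forall j, `|x j - y j| <= d) -> sqdist x a <= sqdist y a + 2 * n%:R * d.
Proof.
move=> xc yc ac xy; rewrite -mulrA mulrCA mulr_natl -[X in _ *+ X]card_ord -sumr_const.
rewrite -big_split; apply: ler_sum => j _ /=.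
have := xy j; rewrite ler_norml => /andP[lo up].
have /andP[x0 x1] := xc j; have /andP[y0 y1] := yc j; have /andP[a0 a1] := ac j.
have d0 : 0 <= d by lra.
have -> : (x j - a j) ^+ 2 = (y j - a j) ^+ 2 + (x j - y j) * (x j + y j - 2 * a j) by ring.
rewrite lerD2l; apply: le_trans (ler_norm _) _; rewrite normrM mulrC.
by apply: ler_pM => //; rewrite ler_norml; apply/andP; split; lra.
Qed.

Lemma sqdist_step x y a j : (forall i, i != j -> y i = x i) ->
  sqdist y a = sqdist x a + (2 * (y j - x j) * (x j - a j) + (y j - x j) ^+ 2).
Proof.
move=> yx; rewrite /sqdist (bigD1 j)//= [in RHS](bigD1 j)//=.
rewrite (eq_bigr (fun i => (x i - a i) ^+ 2)) => [|i /yx -> //].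
by ring.
Qed.

Lemma expRN_le (y : R) : `|y| <= 2^-1 -> expR (- y) <= 1 - y + 2 * y ^+ 2.
Proof.
rewrite ler_norml => /andP[y0 y1].
rewrite expRN -[leLHS]mul1r ler_pdivrMr ?expR_gt0//.
have e := expR_ge1Dx y.
have q0 : 0 <= 1 - y + 2 * y ^+ 2 by nra.
apply: (@le_trans _ _ ((1 - y + 2 * y ^+ 2) * (1 + y))); last exact: ler_wpM2l.
have -> : (1 - y + 2 * y ^+ 2) * (1 + y) = 1 + y ^+ 2 * (1 + 2 * y) by ring.
by rewrite lerDl mulr_ge0 ?sqr_ge0//; lra.
Qed.

Section soft_minimum.
Variables (T : finType) (t0 : T) (a : T -> 'I_n -> R) (kap : R).
Hypothesis kap0 : 0 < kap.

Definition soft_weight (t : T) x : R := expR (- (sqdist x (a t) / kap)).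
Definition soft_mass x : R := \sum_t soft_weight t x.
Definition soft_prob t x : R := soft_weight t x / soft_mass x.

(** A smooth approximation of the squared distance to the finite set of the
    [a t]: the soft minimum at temperature [kap] of the squared distances. *)
Definition soft_sqdist x : R := kap * (ln #|T|%:R - ln (soft_mass x)).

Let wt := soft_weight.
Let Z := soft_mass.
Let p := soft_prob.
Let F := soft_sqdist.

Let card_gt0 : 0 < #|T|%:R :> R.
Proof. by rewrite ltr0n; apply/card_gt0P; exists t0. Qed.

Let wt_gt0 t x : 0 < wt t x. Proof. exact: expR_gt0. Qed.

Let wt_le_Z t x : wt t x <= Z x.
Proof. by rewrite /Z /soft_mass (bigD1 t)//= lerDl sumr_ge0// => i _; exact/ltW/wt_gt0. Qed.

Let Z_gt0 x : 0 < Z x. Proof. exact: lt_le_trans (wt_gt0 t0 x) (wt_le_Z _ _). Qed.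

Lemma soft_prob_ge0 t x : 0 <= p t x.
Proof. by rewrite divr_ge0 ?ltW ?wt_gt0 ?Z_gt0. Qed.

Let p_ge0 := soft_prob_ge0.

Lemma sum_soft_prob x : \sum_t p t x = 1.
Proof. by rewrite -mulr_suml divff// gt_eqF ?Z_gt0. Qed.

Lemma soft_sqdist_le t x : F x <= sqdist x (a t) + kap * ln #|T|%:R.
Proof.
have : - (sqdist x (a t) / kap) <= ln (Z x).
  by rewrite -[leLHS]expRK ler_ln ?posrE ?expR_gt0 ?Z_gt0//; exact: wt_le_Z.
rewrite -(ler_pM2l kap0) mulrN mulrCA divff ?gt_eqF// mulr1 => le.
by rewrite /F /soft_sqdist mulrBr; lra.
Qed.

Lemma soft_sqdist_ge x (d : R) : (forall t, d <= sqdist x (a t)) -> d <= F x.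
Proof.
move=> dx.
have ZC : Z x <= #|T|%:R * expR (- (d / kap)).
  rewrite mulr_natl -sumr_const; apply: ler_sum => t _.
  by rewrite ler_expR lerN2 ler_pM2r ?invr_gt0.
move: ZC; rewrite -ler_ln ?posrE ?Z_gt0 ?mulr_gt0 ?expR_gt0//.
rewrite lnM ?posrE ?expR_gt0// expRK -(ler_pM2l kap0) mulrDr mulrN mulrCA divff ?gt_eqF// mulr1.
by rewrite /F /soft_sqdist mulrBr; lra.
Qed.

(** Gibbs' variational principle: [soft_sqdist x] is the mean of the squared
    distances under [soft_prob], plus [kap] times the relative entropy of
    [soft_prob] with respect to the uniform distribution, which is
    nonnegative. *)
Lemma soft_mean_sqdist_le x : \sum_t p t x * sqdist x (a t) <= F x.
Proof.
have z0 := Z_gt0 x.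
have lnp t : ln (p t x) = - (sqdist x (a t) / kap) - ln (Z x).
  by rewrite lnM ?posrE ?invr_gt0 ?wt_gt0// lnV ?posrE// expRK.
have kl : \sum_t p t x * (sqdist x (a t) / kap + ln (Z x) - ln #|T|%:R) <= 0.
  have sum0 : \sum_(t : T) (#|T|%:R^-1 - p t x) = 0.
    by rewrite sumrB sum_soft_prob sumr_const -[_ *+ _]mulr_natl divff ?subrr// gt_eqF.
  rewrite -[leRHS]sum0; apply: ler_sum => t _.
  have pt0 : 0 < p t x by rewrite divr_gt0 ?wt_gt0.
  have q0 : 0 < (#|T|%:R * p t x)^-1 by rewrite invr_gt0 mulr_gt0.
  have -> : sqdist x (a t) / kap + ln (Z x) - ln #|T|%:R = ln (#|T|%:R * p t x)^-1.
    have q1 : #|T|%:R * p t x \is Num.pos by rewrite posrE mulr_gt0.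
    by rewrite (lnV q1) lnM ?posrE// lnp; ring.
  have -> : #|T|%:R^-1 - p t x = p t x * ((#|T|%:R * p t x)^-1 - 1).
    by field; rewrite !gt_eqF.
  rewrite ler_pM2l//; have := expR_ge1Dx (ln (#|T|%:R * p t x)^-1).
  by rewrite lnK ?posrE//; lra.
have : \sum_t p t x * sqdist x (a t) / kap + (ln (Z x) - ln #|T|%:R) <= 0.
  apply: le_trans kl; rewrite -[X in _ + X]mul1r -(sum_soft_prob x) mulr_suml -big_split /=.
  by apply: ler_sum => t _; lra.
rewrite -mulr_suml -(ler_pM2l kap0) mulr0 mulrDr mulrCA divff ?gt_eqF// mulr1.
by rewrite /F /soft_sqdist -opprB mulrN; lra.
Qed.

Lemma soft_sqdist_ge0 x : 0 <= F x.
Proof. by apply: soft_sqdist_ge => t; exact: sqdist_ge0. Qed.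

(** Half the gradient of [soft_sqdist]. *)
Definition soft_drift x (j : 'I_n) : R := \sum_t p t x * (x j - a t j).

(** By Jensen's inequality and [soft_mean_sqdist_le]: the square root of
    [soft_sqdist] has gradient of norm at most 1. *)
Lemma soft_drift_sqr_sum x : \sum_j soft_drift x j ^+ 2 <= F x.
Proof.
apply: le_trans (soft_mean_sqdist_le x).
rewrite (eq_bigr (fun t => \sum_j p t x * (x j - a t j) ^+ 2)); last first.
  by move=> t _; rewrite mulr_sumr.
rewrite exchange_big /=; apply: ler_sum => j _.
rewrite -subr_ge0.
set m := soft_drift x j.
have -> : \sum_t p t x * (x j - a t j) ^+ 2 - m ^+ 2 =
    \sum_t p t x * (x j - a t j - m) ^+ 2.
  rewrite [RHS](eq_bigr (fun t => p t x * (x j - a t j) ^+ 2 - 2 * m * (p t x * (x j - a t j))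
    + m ^+ 2 * p t x)); last by move=> t _; ring.
  rewrite big_split sumrB /= -!mulr_sumr sum_soft_prob -/(soft_drift x j) -/m.
  by ring.
by apply: sumr_ge0 => t _; rewrite mulr_ge0 ?sqr_ge0.
Qed.

(** A second order Taylor bound.  Moving one coordinate by [s] multiplies the
    mass by [exp (- s^2 / kap)] and by a mean of [exp (- u)] with [u] of order
    [s / kap]; that mean is compared with [exp] of the mean of [- u] from below,
    and with the quadratic bound [expRN_le] from above. *)
Lemma soft_sqdist_step x y j : (forall i, i != j -> y i = x i) ->
  (forall t, `|x j - a t j| <= 1) -> `|y j - x j| <= kap / 4 ->
  `|F y - F x - 2 * (y j - x j) * soft_drift x j| <= (1 + 8 / kap) * (y j - x j) ^+ 2.
Proof.
move=> yx x1; set s := y j - x j => s4.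
pose Y t := x j - a t j; pose u t := 2 * s * Y t / kap.
pose m := \sum_t p t x * u t.
have mE : kap * m = 2 * s * soft_drift x j.
  rewrite /m /soft_drift !mulr_sumr; apply: eq_bigr => t _; rewrite /u /Y.
  by field; rewrite gt_eqF.
pose M := \sum_t p t x * expR (- u t).
have ZM : Z y = Z x * (expR (- (s ^+ 2 / kap)) * M).
  rewrite /M !mulr_sumr; apply: eq_bigr => t _.
  rewrite [LHS]/soft_weight (sqdist_step _ _ _ _ yx) -/s.
  have -> : - ((sqdist x (a t) + (2 * s * (x j - a t j) + s ^+ 2)) / kap) =
    - (sqdist x (a t) / kap) + (- (s ^+ 2 / kap) + - u t) by rewrite /u /Y; ring.
  rewrite !expRD -/(soft_weight t x) /p /soft_prob /Z.
  by field; rewrite gt_eqF.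
have u_le t : `|u t| <= 2 * `|s| / kap.
  rewrite /u !normrM normr_nat normfV (gtr0_norm kap0) ler_pM2r ?invr_gt0//.
  by rewrite ler_piMr ?mulr_ge0//; exact: x1.
have u_half t : `|u t| <= 2^-1.
  apply: le_trans (u_le t) _; rewrite ler_pdivrMr//; lra.
have M_ge : expR (- m) <= M.
  have tangent t : p t x * (expR (- m) * (1 + (m - u t))) <= p t x * expR (- u t).
    rewrite ler_wpM2l//; have e : - u t = - m + (m - u t) by ring.
    by rewrite [in leRHS]e expRD ler_wpM2l ?expR_ge0// expR_ge1Dx.
  apply: le_trans (ler_sum _ (fun t _ => tangent t)).
  rewrite (eq_bigr (fun t => expR (- m) * (1 + m) * p t x - expR (- m) * (p t x * u t))); last first.
    by move=> t _; ring.
  rewrite sumrB -!mulr_sumr sum_soft_prob -/m.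
  by lra.
have M_gt0 : 0 < M by apply: lt_le_trans M_ge; exact: expR_gt0.
have M_le : M <= 1 - m + 8 * s ^+ 2 / kap ^+ 2.
  have quad t : p t x * expR (- u t) <= p t x * (1 + 8 * s ^+ 2 / kap ^+ 2) - p t x * u t.
    rewrite -mulrBr ler_wpM2l// (le_trans (expRN_le _ (u_half t)))//.
    have : u t ^+ 2 <= 4 * s ^+ 2 / kap ^+ 2.
      rewrite -[u t ^+ 2]real_normK ?num_real//.
      have -> : 4 * s ^+ 2 / kap ^+ 2 = (2 * `|s| / kap) ^+ 2.
        by rewrite -[in LHS](real_normK (num_real s)); field; rewrite gt_eqF.
      by rewrite lerXn2r ?nnegrE// mulr_ge0 ?mulr_ge0 ?invr_ge0// ltW.
    by lra.
  apply: le_trans (ler_sum _ (fun t _ => quad t)) _.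
  by rewrite sumrB -mulr_suml sum_soft_prob -/m; lra.
have lnM_ge : - m <= ln M by rewrite -[leLHS]expRK ler_ln ?posrE ?expR_gt0.
have lnM_le : ln M <= M - 1.
  by have := expR_ge1Dx (ln M); rewrite lnK ?posrE//; lra.
have FE : F y - F x = s ^+ 2 - kap * ln M.
  rewrite /F /soft_sqdist -/(Z y) ZM lnM ?posrE ?Z_gt0 ?mulr_gt0 ?expR_gt0//.
  rewrite lnM ?posrE ?expR_gt0// expRK -/(Z x).
  by field; rewrite gt_eqF.
have k1 : kap * - m <= kap * ln M by rewrite ler_pM2l.
have k2 : kap * ln M <= kap * (- m + 8 * s ^+ 2 / kap ^+ 2) by rewrite ler_pM2l//; lra.
have k3 : kap * (- m + 8 * s ^+ 2 / kap ^+ 2) = - (kap * m) + 8 / kap * s ^+ 2.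
  by field; rewrite gt_eqF.
have s2 : 0 <= s ^+ 2 by exact: sqr_ge0.
have k8 : 0 <= 8 / kap * s ^+ 2 by rewrite mulr_ge0 ?divr_ge0 ?(ltW kap0).
rewrite FE -mE ler_norml mulrDl mul1r; apply/andP; split; lra.
Qed.

End soft_minimum.
End soft_distance.

(** * Soft distance to a set *)

Section slowly_varying.
Context {R : realType} {n : nat}.
Implicit Types x y : 'I_n -> R.

(** In one coordinate step, [G] changes to first order by at most [c j] per unit
    length, where [c] has Euclidean norm at most 1, and the second order error is
    uniform.  For smooth [G] this is the bound 1 on the norm of the gradient.  The
    Lipschitz constant 1 alone would bound the sum over the coordinates of the
    squared increments only by [n]. *)
Definition slowly_varying (G : ('I_n -> R) -> R) (C s0 : R) : Prop :=
  forall x, in_cube x -> exists c : 'I_n -> R,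
    [/\ forall j, 0 <= c j, \sum_j c j ^+ 2 <= 1 &
      forall j y, in_cube y -> (forall i, i != j -> y i = x i) ->
        `|y j - x j| <= s0 ->
        `|G y - G x| <= `|y j - x j| * c j + C * (y j - x j) ^+ 2].

(** From a step of [f] to a step of its square root, when [f] is bounded below by
    [h ^+ 2].  If [e] is the change of the root, then [2 sqrt f1 e] differs from the
    change of [f] by at most [e ^+ 2], which is of second order. *)
Lemma sqrt_step (f1 f2 s d h C1 : R) : 0 < h -> h ^+ 2 <= f1 -> h ^+ 2 <= f2 ->
  0 <= C1 -> `|s| <= 1 -> `|d| <= 1 ->
  `|f2 - f1 - 2 * s * d| <= C1 * s ^+ 2 ->
  `|Num.sqrt f2 - Num.sqrt f1| <= `|s| * (`|d| / Num.sqrt f1) +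
    (C1 + ((2 + C1) / (2 * h)) ^+ 2) / (2 * h) * s ^+ 2.
Proof.
move=> h0 hf1 hf2 C10 s1 d1 df.
have h2 : 0 < h ^+ 2 by rewrite exprn_gt0.
have g1h : h <= Num.sqrt f1 by rewrite -(ger0_norm (ltW h0)) -sqrtr_sqr ler_wsqrtr.
have g2h : h <= Num.sqrt f2 by rewrite -(ger0_norm (ltW h0)) -sqrtr_sqr ler_wsqrtr.
have f1E : f1 = Num.sqrt f1 ^+ 2 by rewrite sqr_sqrtr//; lra.
have f2E : f2 = Num.sqrt f2 ^+ 2 by rewrite sqr_sqrtr//; lra.
set g1 := Num.sqrt f1 in g1h f1E *; set g2 := Num.sqrt f2 in g2h f2E *.
have g10 : 0 < g1 by lra.
have s0 := normr_ge0 s.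
have s2E : s ^+ 2 = `|s| ^+ 2 by rewrite real_normK ?num_real.
have df_le : `|f2 - f1| <= 2 * `|s| * `|d| + C1 * s ^+ 2.
  have -> : f2 - f1 = 2 * s * d + (f2 - f1 - 2 * s * d) by ring.
  by apply: le_trans (ler_normD _ _) _; rewrite !normrM normr_nat lerD2l.
have dfE : `|f2 - f1| = `|g2 - g1| * (g1 + g2).
  rewrite f1E f2E -[g1 + g2]ger0_norm -?normrM; last by lra.
  by congr (`|_|); ring.
set e := `|g2 - g1| in dfE *; have e0 : 0 <= e by exact: normr_ge0.
have df_lin : `|f2 - f1| <= (2 + C1) * `|s|.
  apply: le_trans df_le _; have -> : (2 + C1) * `|s| = 2 * `|s| + C1 * `|s| by ring.
  apply: lerD.
    by rewrite ler_piMr// mulr_ge0.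
  by rewrite s2E expr2 ler_wpM2l// ler_piMl.
have e_lin : e <= (2 + C1) / (2 * h) * `|s|.
  rewrite mulrAC ler_pdivlMr ?mulr_gt0//; apply: le_trans df_lin.
  by rewrite dfE ler_wpM2l//; lra.
have e_sqr : e ^+ 2 <= ((2 + C1) / (2 * h)) ^+ 2 * s ^+ 2.
  rewrite s2E -exprMn lerXn2r ?nnegrE//; by apply: le_trans e_lin.
have two_e : 2 * g1 * e <= `|f2 - f1| + e ^+ 2.
  have -> : 2 * g1 * e = e * (g1 + g2) + e * (g1 - g2) by ring.
  by rewrite dfE lerD2l expr2 ler_wpM2l// /e distrC ler_norm.
have e_le : e <= (2 * `|s| * `|d| + (C1 + ((2 + C1) / (2 * h)) ^+ 2) * s ^+ 2) / (2 * g1).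
  rewrite ler_pdivlMr ?mulr_gt0// mulrC.
  by apply: le_trans two_e _; rewrite mulrDl; lra.
apply: le_trans e_le _; rewrite mulrDl; apply: lerD.
  by rewrite le_eqVlt; apply/orP; left; apply/eqP; field; rewrite gt_eqF.
rewrite mulrAC ler_wpM2r ?sqr_ge0// ler_wpM2l ?addr_ge0 ?sqr_ge0//.
by rewrite lef_pV2 ?posrE ?mulr_gt0// ler_pM2l.
Qed.

(** The regularisation by [eta] keeps the square root away from its
    singularity. *)
Lemma soft_distance_slowly_varying (T : finType) (t0 : T) (a : T -> 'I_n -> R)
    (kap eta : R) : 0 < kap -> 0 < eta -> (forall t, in_cube (a t)) ->
  exists2 C, 0 <= C &
    slowly_varying (fun x => Num.sqrt (soft_sqdist T a kap x + eta)) C (kap / 4).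
Proof.
move=> kap0 eta0 ac; pose C1 := 1 + 8 / kap; pose h := Num.sqrt eta.
have C10 : 0 <= C1 by rewrite addr_ge0// divr_ge0// ltW.
have h0 : 0 < h by rewrite sqrtr_gt0.
have hE : h ^+ 2 = eta by rewrite sqr_sqrtr// ltW.
exists ((C1 + ((2 + C1) / (2 * h)) ^+ 2) / (2 * h)).
  have h00 := ltW h0; apply: divr_ge0; last exact: mulr_ge0.
  by apply: addr_ge0 => //; exact: sqr_ge0.
move=> x xc; pose d := soft_drift T a kap x; pose g := Num.sqrt (soft_sqdist T a kap x + eta).
have F0 y : 0 <= soft_sqdist T a kap y by exact: soft_sqdist_ge0.
have f0 : 0 < soft_sqdist T a kap x + eta by have := F0 x; lra.
have ax1 t j : `|x j - a t j| <= 1.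
  have /andP[? ?] := xc j; have /andP[? ?] := ac t j.
  by rewrite ler_norml; apply/andP; split; lra.
exists (fun j => `|d j| / g); split=> [j||j y yc yx ys].
- by rewrite divr_ge0 ?sqrtr_ge0.
- rewrite (eq_bigr (fun j => d j ^+ 2 / (soft_sqdist T a kap x + eta))); last first.
    by move=> j _; rewrite expr_div_n real_normK ?num_real// sqr_sqrtr// ltW.
  rewrite -mulr_suml ler_pdivrMr// mul1r.
  by apply: (le_trans (soft_drift_sqr_sum T t0 a kap kap0 x)); lra.
have d1 : `|d j| <= 1.
  apply: le_trans (ler_norm_sum _ _ _) _.
  rewrite -(sum_soft_prob T t0 a kap x); apply: ler_sum => t _.
  by rewrite normrM ger0_norm ?soft_prob_ge0// ler_piMr ?soft_prob_ge0.
apply: sqrt_step => //; rewrite ?hE.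
- by rewrite lerDr.
- by rewrite lerDr.
- have /andP[? ?] := xc j; have /andP[? ?] := yc j.
  by rewrite ler_norml; apply/andP; split; lra.
have -> : soft_sqdist T a kap y + eta - (soft_sqdist T a kap x + eta) =
  soft_sqdist T a kap y - soft_sqdist T a kap x by ring.
exact: soft_sqdist_step.
Qed.

(** One point of [A] is chosen in each cell of a fine regular grid that meets
    [A]; for the other cells [a0] is taken, so that the index type is the
    type of all cells. *)
Lemma finite_net (A : set ('I_n -> R)) (a0 : 'I_n -> R) (r : R) : A a0 ->
  (forall x, A x -> in_cube x) -> 0 < r ->
  exists (T : finType) (a : T -> 'I_n -> R), (forall t, A (a t)) /\
    forall x, A x -> exists t, sqdist x (a t) <= r.
Proof.
move=> Aa0 Ac r0.
have [K Kr] : exists K : nat, n%:R / r <= K.+1%:R.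
  exists (Num.truncn (n%:R / r)); apply/ltW/Num.Theory.truncnS_gt.
pose code x : {ffun 'I_n -> 'I_K.+2} := [ffun j => inord (Num.truncn (K.+1%:R * x j))].
have K0 : 0 < K.+1%:R :> R by rewrite ltr0n.
have truncn_lt x j : in_cube x -> (Num.truncn (K.+1%:R * x j) < K.+2)%N.
  move=> xc; have /andP[x0 x1] := xc j.
  rewrite truncn_lt_nat ?mulr_ge0// ?(ltW K0)//.
  by apply: (@le_lt_trans _ _ K.+1%:R); [rewrite ler_piMr// ltW|rewrite ltr_nat].
pose rep t := if pselect (exists2 x, A x & code x = t) is left e
  then projT1 (cid2 e) else a0.
have repP t : A (rep t) /\ ((exists2 x, A x & code x = t) -> code (rep t) = t).
  by rewrite /rep; case: pselect => //= e; case: (cid2 e) => x.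
exists {ffun 'I_n -> 'I_K.+2}, rep; split=> [t|x Ax]; first exact: (repP t).1.
exists (code x); have Ay := (repP (code x)).1; set y := rep (code x) in Ay *.
have cxy : code y = code x by apply: (repP (code x)).2; exists x.
have close j : `|x j - y j| <= K.+1%:R^-1.
  have /ffunP/(_ j) := cxy; rewrite !ffunE => /(congr1 val) /=.
  rewrite !inordK; [|exact/truncn_lt/Ac|exact/truncn_lt/Ac] => E.
  have /andP[x0 x1] := Ac x Ax j; have /andP[y0 y1] := Ac y Ay j.
  have := truncn_itv (mulr_ge0 (ltW K0) x0); have := truncn_itv (mulr_ge0 (ltW K0) y0).
  rewrite E -(natr1 (Num.truncn _)) => /andP[p1 p2] /andP[p3 p4].
  rewrite -[leRHS]mul1r ler_pdivlMr// mulrC -[X in X * _]gtr0_norm// -normrM.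
  by rewrite ler_norml mulrBr; apply/andP; split; lra.
apply: (le_trans (sqdist_le_dim x y _ close)).
have K1 : 1 <= K.+1%:R :> R by rewrite ler1n.
move: Kr; rewrite !ler_pdivrMr// => Kr.
rewrite exprVn ler_pdivrMr ?exprn_gt0// (le_trans Kr)//.
by rewrite mulrC expr2 ler_wpM2l ?(ltW r0)// ler_pMr.
Qed.

End slowly_varying.

Section soft_distance_to_set.
Context {R : realType} {n : nat}.

(** The soft distance to a fine net of [A].  Near [A] its square has four
    contributions, each of which is allotted a quarter of [theta ^+ 2]: the mesh of
    the net, the distance [s0] to [A], the entropy term [kap * ln #|T|], and the
    regularisation. *)
Lemma soft_distance_function (A : set ('I_n -> R)) (a0 : 'I_n -> R) (theta : R) :
  A a0 -> (forall x, A x -> in_cube x) -> 0 < theta ->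
  exists (G : ('I_n -> R) -> R) (C s0 Gm : R),
  [/\ 0 <= C, 0 < s0, slowly_varying G C s0, forall x, in_cube x -> 0 <= G x <= Gm &
    (forall a x, A a -> in_cube x -> (forall j, `|x j - a j| <= s0) -> G x <= theta) /\
    (forall D b x, 0 <= D -> in_cube b -> (forall a, A a -> D ^+ 2 <= sqdist b a) ->
      in_cube x -> (forall j, `|x j - b j| <= s0) -> D - theta <= G x)].
Proof.
move=> Aa0 Ac th0; have th2 : 0 < theta ^+ 2 by rewrite exprn_gt0.
pose q := theta ^+ 2 / 4; have q0 : 0 < q by rewrite divr_gt0.
have qE : theta ^+ 2 = 4 * q by rewrite /q; field.
have [T [a [aA net]]] := finite_net A a0 q Aa0 Ac q0.
have [t0 _] := net _ Aa0.
have T1 : 1 <= #|T|%:R :> R by rewrite ler1n; apply/card_gt0P; exists t0.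
have lnT : 0 <= ln #|T|%:R :> R by rewrite ln_ge0.
pose kap := q / (1 + ln #|T|%:R).
have kap0 : 0 < kap by rewrite divr_gt0//; lra.
have kapT : kap * ln #|T|%:R <= q.
  by rewrite /kap mulrAC ler_pdivrMr ?ler_pM2l//; lra.
have [C C0 slow] := soft_distance_slowly_varying T t0 a kap q kap0 q0 (fun t => Ac _ (aA t)).
have F0 x : 0 <= soft_sqdist T a kap x by exact: soft_sqdist_ge0.
pose s0 := Num.min (kap / 4) (q / (2 * n%:R + 1)).
have n1 : 0 < 2 * n%:R + 1 :> R by rewrite ltr_pwDr// mulr_ge0.
have s00 : 0 < s0 by rewrite lt_min; apply/andP; split; apply: divr_gt0.
have s0kap : s0 <= kap / 4 by rewrite ge_min lexx.
have s0n : 2 * n%:R * s0 <= q.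
  apply: (@le_trans _ _ ((2 * n%:R + 1) * s0)); first by rewrite ler_pM2r//; lra.
  by rewrite mulrC -ler_pdivlMr// ge_min lexx orbT.
exists (fun x => Num.sqrt (soft_sqdist T a kap x + q)), C, s0, (Num.sqrt (n%:R + 2 * q)).
split=> //.
- move=> x xc; have [c [c0 csum cstep]] := slow x xc; exists c; split=> // j y yc yx ys.
  by apply: cstep => //; exact: le_trans ys s0kap.
- move=> x xc; rewrite sqrtr_ge0 ler_wsqrtr//.
  have := soft_sqdist_le T t0 a kap kap0 t0 x.
  have : sqdist x (a t0) <= n%:R * 1 ^+ 2.
    apply: sqdist_le_dim => j; have /andP[? ?] := xc j; have /andP[? ?] := Ac _ (aA t0) j.
    by rewrite ler_norml; apply/andP; split; lra.
  by rewrite expr1n mulr1; lra.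
split=> [b x Ab xc xb|D b x D0 bc far xc xb].
  rewrite -(ger0_norm (ltW th0)) -sqrtr_sqr ler_wsqrtr//.
  have [t bt] := net _ Ab.
  have := soft_sqdist_le T t0 a kap kap0 t x.
  have := sqdist_perturb x b (a t) s0 xc (Ac _ Ab) (Ac _ (aA t)) xb.
  by lra.
have [Dth|Dth] := leP D theta.
  by apply: (@le_trans _ _ 0); [lra|exact: sqrtr_ge0].
have Fge : D ^+ 2 - 2 * n%:R * s0 <= soft_sqdist T a kap x.
  apply: soft_sqdist_ge => // t.
  have bx j : `|b j - x j| <= s0 by rewrite distrC.
  have := sqdist_perturb b x (a t) s0 bc xc (Ac _ (aA t)) bx.
  by have := far _ (aA t); lra.
have Dth0 : 0 <= D - theta by lra.
rewrite -(ger0_norm Dth0) -sqrtr_sqr ler_wsqrtr//.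
have : theta * theta <= D * theta by rewrite ler_pM2r// ltW.
have -> : (D - theta) ^+ 2 = D ^+ 2 - 2 * (D * theta) + theta ^+ 2 by ring.
by rewrite -expr2; lra.
Qed.

End soft_distance_to_set.

(** * Level sets of the soft distance in the coin model *)

Section auxiliary_estimates.
Context {R : realType} {n : nat}.
Notation phi := (@gauss R).

(** The derivative is [2 pi |x| / exp (pi x^2)], and
    [exp (pi x^2) >= 1 + 2 x^2 >= |x|]. *)
Lemma gauss_lipschitz (u v : R) : `|phi v - phi u| <= 2 * pi * `|v - u|.
Proof.
wlog uv : u v / u <= v.
  move=> H; have [/H//|/ltW vu] := leP u v.
  by rewrite distrC [X in _ * X]distrC; exact: H.
have p2 := pi_gt0 R.
have [||c _ E] := @MVT_segment R phi (fun x => - (2 * pi * x) * phi x) u v uv.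
- by move=> x _; exact: is_derive_gauss.
- exact/continuous_subspaceT/continuous_gauss.
rewrite E normrM ler_wpM2r// normrM normrN !normrM normr_nat (ger0_norm (ltW p2)).
rewrite (ger0_norm (ltW (gauss_gt0 _))) -mulrA.
suff : `|c| * phi c <= 1 by move=> le1; rewrite ler_piMr// mulr_ge0// ltW.
rewrite /gauss mulNr expRN ler_pdivrMr ?expR_gt0// mul1r.
apply: le_trans (expR_ge1Dx _); rewrite -[c ^+ 2]real_normK ?num_real//.
have c2 := sqr_ge0 `|c|; have c1 := sqr_ge0 (`|c| - 1).
have : 2 * `|c| ^+ 2 <= pi * `|c| ^+ 2 by rewrite ler_wpM2r// pi_ge2.
by move: c1; rewrite sqrrB1 mulr2n; lra.
Qed.

Lemma Phi_step (u v : R) : `|Phi v - Phi u| <= `|v - u| * (phi u + 2 * pi * `|v - u|).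
Proof.
have key (x y : R) : x <= y -> exists2 c, x <= c <= y & Phi y - Phi x = phi c * (y - x).
  exact: Phi_mvt.
have [c cuv E] : exists2 c, `|c - u| <= `|v - u| & Phi v - Phi u = phi c * (v - u).
  have [uv|vu] := leP u v.
    have [c /andP[c1 c2] E] := key _ _ uv; exists c => //.
    by rewrite !ger0_norm ?subr_ge0// lerD2r.
  have [c /andP[c1 c2] E] := key _ _ (ltW vu); exists c; last by rewrite -opprB E; ring.
  by rewrite !ler0_norm ?subr_le0 ?(ltW vu)// lerN2 lerD2r.
rewrite E normrM mulrC ler_wpM2l// ger0_norm ?(ltW (gauss_gt0 _))//.
have := gauss_lipschitz u c => /(le_trans (ler_norm _)) L.
have p2 := pi_gt0 R.
have : 2 * pi * `|c - u| <= 2 * pi * `|v - u| by rewrite ler_pM2l// mulr_gt0.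
by lra.
Qed.

Lemma sum_blocks (N : nat) (g : nat -> R) : (0 < N)%N ->
  \sum_(i < n * N) g (i %/ N)%N = N%:R * \sum_(j < n) g j.
Proof.
move=> N0; elim: n g => [|k IHk] g; first by rewrite !big_ord0 mulr0.
rewrite mulSn big_split_ord big_ord_recl mulrDr /=; congr (_ + _).
  rewrite (eq_bigr (fun=> g 0%N)); last by move=> i _; rewrite divn_small.
  by rewrite sumr_const card_ord mulr_natl.
rewrite -(IHk (fun j => g j.+1)); apply: eq_bigr => i _.
by rewrite divnDl// divnn N0.
Qed.

Lemma is_derive_coin_mean k (g dg : R -> seq bool -> R) (c : R) :
  (forall s, is_derive c (1 : R) (g^~ s) (dg c s)) ->
  is_derive c (1 : R) (fun c => coin_mean k (g c)) (coin_mean k (dg c)).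
Proof.
elim: k g dg => [|k IHk] g dg D /=; first exact: D.
have Dt := IHk (fun c s => g c (true :: s)) (fun c s => dg c (true :: s)) (fun s => D _).
have Df := IHk (fun c s => g c (false :: s)) (fun c s => dg c (false :: s)) (fun s => D _).
have -> : (fun c0 => (coin_mean k (fun s => g c0 (true :: s)) +
    coin_mean k (fun s => g c0 (false :: s))) / 2) =
  (fun c0 => 2^-1 * ((coin_mean k (fun s => g c0 (true :: s)) +
    coin_mean k (fun s => g c0 (false :: s))))) by apply/funext => y; rewrite mulrC.
rewrite mulrC.
exact: (is_deriveZ 2^-1 (is_deriveD Dt Df)).
Qed.

End auxiliary_estimates.

Section grid.
Context {R : realType} {n : nat}.
Notation Psi := (@Phi_inv R).
Notation phi := (@gauss R).
Notation I := (@gauss_profile R).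

(** The upper corner of the cell picked by the coins [s]. *)
Definition grid_point (m : nat) (s : seq bool) : 'I_n -> R :=
  fun j => binomial_cdf m.*2 (block_count m.*2 j s).+1.

Lemma grid_point_in_cube m s : in_cube (grid_point m s).
Proof. by move=> j; apply: binomial_cdf_itv; rewrite ltnS block_count_le. Qed.

Lemma grid_point_flip m i s (j : 'I_n) : (0 < m)%N -> j = (i %/ m.*2)%N :> nat ->
  (forall k, k != j -> grid_point m (flip i s) k = grid_point m s k) /\
  `|grid_point m (flip i s) j - grid_point m s j| <= central_atom m.
Proof.
move=> m0 ji; have N0 : (0 < m.*2)%N by rewrite double_gt0.
split=> [k kj|].
  rewrite /grid_point block_count_flip_neq// -ji.
  by apply: contraNneq kj => /val_inj ->.
have step k : `|binomial_cdf m.*2 k.+1 - binomial_cdf m.*2 k| <= central_atom m :> R.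
  rewrite binomial_cdfS addrAC subrr add0r ger0_norm; first exact: binomial_atom_le.
  by rewrite divr_ge0 ?exprn_ge0.
rewrite /grid_point ji.
by have [->|->] := block_count_flip_eq m.*2 i s N0; [|rewrite distrC]; exact: step.
Qed.

(** Second order coefficient, in the length [d] of a step, of an increment of
    [Phi (lam * (c - G))]. *)
Definition grad_const (lam C : R) : R := lam * C + 2 * pi * lam ^+ 2 * (1 + C) ^+ 2.

Definition grad_error (lam C : R) : R :=
  2 * lam * grad_const lam C + grad_const lam C ^+ 2.

Lemma grad_const_ge0 (lam C : R) : 0 <= lam -> 0 <= C -> 0 <= grad_const lam C.
Proof.
move=> lam0 C0; have p2 := ltW (pi_gt0 R).
apply: addr_ge0; first exact: mulr_ge0.
apply: mulr_ge0; last exact: sqr_ge0.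
by apply: mulr_ge0; [exact: mulr_ge0|exact: sqr_ge0].
Qed.

Lemma grad_error_ge0 (lam C : R) : 0 <= lam -> 0 <= C -> 0 <= grad_error lam C.
Proof.
move=> lam0 C0; have B0 := grad_const_ge0 _ _ lam0 C0.
by rewrite addr_ge0 ?sqr_ge0// !mulr_ge0.
Qed.

(** Here [t] bounds the increment of [lam * (c - G)], [f] is the density at the
    starting point, and [t * (f + 2 pi t)] is the bound of [Phi_step]. *)
Lemma sqr_increment_le (lam C d cj f t : R) : 0 <= lam -> 0 <= C -> 0 <= d <= 1 ->
  0 <= cj <= 1 -> 0 <= f <= 1 -> 0 <= t <= lam * (d * cj + C * d ^+ 2) ->
  (t * (f + 2 * pi * t)) ^+ 2 <=
    d ^+ 2 * (lam ^+ 2 * cj ^+ 2 * f ^+ 2 + grad_error lam C * d).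
Proof.
move=> lam0 C0 /andP[d0 d1] /andP[cj0 cj1] /andP[f0 f1] /andP[t0 tT].
have p2 := ltW (pi_gt0 R).
have B10 := grad_const_ge0 _ _ lam0 C0.
rewrite /grad_error; set B1 := grad_const lam C in B10 *.
pose T := lam * d * (cj + C * d).
have TE : lam * (d * cj + C * d ^+ 2) = T by rewrite /T; ring.
rewrite TE in tT.
have T0 : 0 <= T by apply: le_trans tT.
have T1 : T <= lam * d * (1 + C).
  rewrite ler_wpM2l ?mulr_ge0// lerD// ler_piMr//.
have tTp : t * (f + 2 * pi * t) <= T * (f + 2 * pi * T).
  by rewrite ler_pM ?addr_ge0 ?mulr_ge0// lerD2l ler_wpM2l// mulr_ge0.
have TB : T * (f + 2 * pi * T) <= d * (lam * cj * f + B1 * d).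
  have -> : T * (f + 2 * pi * T) = d * (lam * cj * f) + lam * C * d ^+ 2 * f + 2 * pi * T ^+ 2.
    by rewrite /T; ring.
  have -> : d * (lam * cj * f + B1 * d) = d * (lam * cj * f) + lam * C * d ^+ 2 +
     2 * pi * (lam * d * (1 + C)) ^+ 2 by rewrite /B1 /grad_const; ring.
  apply: lerD; first by rewrite lerD2l ler_piMr// !mulr_ge0 ?sqr_ge0.
  by rewrite ler_wpM2l ?mulr_ge0// lerXn2r ?nnegrE// mulr_ge0 ?mulr_ge0// addr_ge0.
have tB := le_trans tTp TB.
apply: (@le_trans _ _ ((d * (lam * cj * f + B1 * d)) ^+ 2)).
  rewrite lerXn2r ?nnegrE// ?mulr_ge0 ?addr_ge0 ?mulr_ge0//.
rewrite exprMn ler_wpM2l ?sqr_ge0//.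
have -> : (lam * cj * f + B1 * d) ^+ 2 = lam ^+ 2 * cj ^+ 2 * f ^+ 2 +
  (2 * lam * B1 * (cj * f) + B1 ^+ 2 * d) * d by ring.
rewrite lerD2l ler_wpM2r// lerD//.
  by rewrite ler_piMr ?mulr_ge0// mulr_ile1.
by rewrite ler_piMr ?sqr_ge0.
Qed.

Section slow_function.
Variables (G : ('I_n -> R) -> R) (C s0 Gm lam : R).
Hypotheses (C0 : 0 <= C) (slow : slowly_varying G C s0) (lam0 : 0 < lam).
Hypothesis Gbnd : forall x, in_cube x -> 0 <= G x <= Gm.

(** A smooth version of the indicator function of the set where [G < c]; the
    transition takes place over a layer of width of order [1 / lam]. *)
Definition soft_level (m : nat) (c : R) (s : seq bool) : R :=
  Phi (lam * (c - G (grid_point m s))).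

Definition soft_volume (m : nat) (c : R) : R :=
  coin_mean (n * m.*2) (soft_level m c).

(** Each of the [m.*2] coins of a coordinate moves that coordinate by at most
    [d = central_atom m].  Together they contribute at most
    [pi m d^2 <= 1] times the squared partial derivative, and the sum over the
    coordinates is bounded by [slowly_varying]. *)
Lemma grad_soft_level_le m c s : (0 < m)%N -> central_atom m <= s0 ->
  (central_atom m : R) <= 1 ->
  2 * pi * discrete_grad2 (n * m.*2) (soft_level m c) s <=
  lam ^+ 2 * phi (lam * (c - G (grid_point m s))) ^+ 2
    + n%:R * grad_error lam C * central_atom m.
Proof.
move=> m0 ds ds1; set x := grid_point m s; set u := lam * (c - G x).
have N0 : (0 < m.*2)%N by rewrite double_gt0.
set d := central_atom m in ds ds1 *.
have d0 : 0 < d by exact: central_atom_gt0.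
have [cc [cc0 cc1 step]] := slow x (grid_point_in_cube m s).
pose c' (k : nat) : R := oapp cc 0 (insub k).
pose gk (k : nat) : R :=
  d ^+ 2 / 4 * (lam ^+ 2 * c' k ^+ 2 * phi u ^+ 2 + grad_error lam C * d).
have incr (i : 'I_(n * m.*2)) :
    ((soft_level m c (flip i s) - soft_level m c s) / 2) ^+ 2 <=
    gk (i %/ m.*2)%N.
  have jn : (i %/ m.*2 < n)%N by rewrite ltn_divLR.
  pose j := Ordinal jn.
  have [yx yj] := grid_point_flip m i s j m0 erefl.
  rewrite /gk; have -> : c' (i %/ m.*2)%N = cc j by rewrite /c' -[(i %/ m.*2)%N]/(val j) valK.
  have ccj1 : cc j <= 1.
    rewrite -(@ler_pXn2r _ 2) ?nnegrE// expr1n; apply: le_trans cc1.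
    by rewrite (bigD1 j)//= lerDl sumr_ge0// => k _; exact: sqr_ge0.
  have := step j _ (grid_point_in_cube m _) yx (le_trans yj ds).
  set y := grid_point m (flip i s) in yx yj *; rewrite -/x => Gstep.
  set v := lam * (c - G y).
  have vu : `|v - u| <= lam * (d * cc j + C * d ^+ 2).
    have -> : v - u = lam * (G x - G y) by rewrite /v /u; ring.
    rewrite normrM gtr0_norm// ler_pM2l// distrC; apply: le_trans Gstep _.
    apply: lerD; first by rewrite ler_wpM2r.
    rewrite ler_wpM2l// -[X in X <= _]real_normK ?num_real// lerXn2r ?nnegrE// ltW//.
  have := sqr_increment_le lam C d (cc j) (phi u) `|v - u| (ltW lam0) C0.
  rewrite (ltW d0) ds1 cc0 ccj1 (ltW (gauss_gt0 u)) gauss_le1 normr_ge0 vu.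
  move=> /(_ isT isT isT isT) sqle.
  have Ple := Phi_step u v.
  have -> : ((soft_level m c (flip i s) - soft_level m c s) / 2) ^+ 2 =
    `|Phi v - Phi u| ^+ 2 / 4.
    by rewrite real_normK ?num_real// /soft_level -/x -/y -/u -/v; field.
  rewrite [leRHS]mulrAC ler_pM2r ?invr_gt0//; apply: le_trans sqle.
  by rewrite lerXn2r ?nnegrE//; apply: le_trans Ple.
have p2 := pi_gt0 R.
apply: (@le_trans _ _ (2 * pi * \sum_(i < n * m.*2)
   gk (i %/ m.*2)%N)).
  by rewrite ler_pM2l ?mulr_gt0//; apply: ler_sum => i _; exact: incr.
rewrite (sum_blocks _ gk N0) -mulr_sumr big_split /= -mulr_suml -mulr_sumr.
rewrite sumr_const card_ord -[_ *+ n]mulr_natl.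
have -> : \sum_(i < n) c' i ^+ 2 = \sum_(i < n) cc i ^+ 2.
  by apply: eq_bigr => i _; rewrite /c' valK.
have -> : m.*2%:R = 2 * m%:R :> R by rewrite -natrM mul2n.
set S := \sum_(i < n) cc i ^+ 2 in cc1 *.
have S0 : 0 <= S by apply: sumr_ge0 => k _; exact: sqr_ge0.
have W := central_atom_sqr_le m m0; rewrite -/d in W.
have -> : 2 * pi * (2 * m%:R * (d ^+ 2 / 4 *
    (lam ^+ 2 * S * phi u ^+ 2 + n%:R * (grad_error lam C * d)))) =
  pi * m%:R * d ^+ 2 * (lam ^+ 2 * S * phi u ^+ 2 + n%:R * (grad_error lam C * d)) by field.
have B0 := grad_error_ge0 _ _ (ltW lam0) C0.
apply: (@le_trans _ _ (lam ^+ 2 * S * phi u ^+ 2 + n%:R * (grad_error lam C * d))).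
  apply: ler_piMl; last (exact: W); apply: addr_ge0.
    by apply: mulr_ge0 (sqr_ge0 _); exact: mulr_ge0 (sqr_ge0 _) S0.
  by apply: mulr_ge0 => //; apply: mulr_ge0 => //; exact: ltW.
by rewrite mulrA lerD2r ler_wpM2r ?sqr_ge0// ler_piMr ?sqr_ge0.
Qed.

End slow_function.
End grid.

Section expansion.
Context {R : realType} {n : nat}.
Notation Psi := (@Phi_inv R).
Notation phi := (@gauss R).
Notation I := (@gauss_profile R).
Variables (G : ('I_n -> R) -> R) (C s0 Gm lam : R).
Hypotheses (C0 : 0 <= C) (slow : slowly_varying G C s0) (lam0 : 0 < lam).
Hypothesis Gbnd : forall x, in_cube x -> 0 <= G x <= Gm.

Let vol := soft_volume G lam.
Let dvol m c := lam * coin_mean (n * m.*2) (fun s => phi (lam * (c - G (grid_point m s)))).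

Lemma soft_volume_itv m c : 0 < vol m c < 1.
Proof. by apply: coin_mean_itv => s _; rewrite Phi_gt0 Phi_lt1. Qed.

Lemma is_derive_soft_volume m c : is_derive c (1 : R) (vol m) (dvol m c).
Proof.
rewrite /dvol -coin_meanZ.
apply: (is_derive_coin_mean _ (soft_level G lam m)
  (fun c s => lam * phi (lam * (c - G (grid_point m s))))) => s.
rewrite mulrC.
apply: (@is_derive1_comp R (@Phi R) (fun c0 => lam * (c0 - G (grid_point m s)))).
  exact: is_derive_Phi.
have := is_deriveZ lam (is_deriveB (is_derive_id c (1 : R)) (is_derive_cst (G (grid_point m s)) c (1 : R))).
by rewrite subr0 /GRing.scale /= mulr1.
Qed.

(** Bobkov's inequality for [soft_level]: its profile is the density
    [phi (lam * (c - G))], the increments contribute at most [lam] times the same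
    density, and the mean of that density is [dvol m c / lam]. *)
Lemma soft_volume_isoperimetry m c : (0 < m)%N -> central_atom m <= s0 ->
  (central_atom m : R) <= 1 ->
  I (vol m c) <= Num.sqrt (1 + lam ^+ 2) * (dvol m c / lam) +
    Num.sqrt (n%:R * grad_error lam C * central_atom m).
Proof.
move=> m0 ds d1; set err := n%:R * _ * _.
have err0 : 0 <= err.
  apply: mulr_ge0; last exact/ltW/central_atom_gt0.
  by apply: mulr_ge0 => //; exact: grad_error_ge0 (ltW lam0) C0.
have l1 : 0 <= 1 + lam ^+ 2 by rewrite addr_ge0 ?sqr_ge0.
apply: le_trans (bobkov_cube _ _ _) _ => [s _|]; first by rewrite Phi_gt0 Phi_lt1.
have -> : dvol m c / lam =
    coin_mean (n * m.*2) (fun s => phi (lam * (c - G (grid_point m s)))).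
  by rewrite /dvol mulrC mulKf// gt_eqF.
rewrite -coin_meanZ -[X in _ <= _ + X](coin_mean_cst (n * m.*2)) -coin_meanD.
apply: coin_mean_le => s _; set u := lam * (c - G (grid_point m s)).
have uE : I (soft_level G lam m c s) = phi u by rewrite /gauss_profile PhiK.
rewrite uE.
apply: (@le_trans _ _ (Num.sqrt ((Num.sqrt (1 + lam ^+ 2) * phi u + 0) ^+ 2 + (0 + Num.sqrt err) ^+ 2))).
  rewrite ler_wsqrtr// addr0 add0r exprMn !sqr_sqrtr//.
  have -> : (1 + lam ^+ 2) * phi u ^+ 2 + err = phi u ^+ 2 + (lam ^+ 2 * phi u ^+ 2 + err).
    by ring.
  rewrite lerD2l.
  exact: (@grad_soft_level_le _ _ G C s0 lam C0 slow lam0).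
apply: le_trans (sqrt_addr_sqr_le _ _ _ _) _.
rewrite expr0n addr0 add0r !sqrtr_sqr !ger0_norm ?sqrtr_ge0//.
by rewrite mulr_ge0 ?sqrtr_ge0 ?ltW ?gauss_gt0.
Qed.

(** The profile stays away from 0 uniformly in [m], which turns the additive error
    of [soft_volume_isoperimetry] into a relative one. *)
Lemma soft_volume_profile_ge m c V : `|c| + Gm <= V -> phi (lam * V) <= I (vol m c).
Proof.
move=> cV.
have uV s : `|lam * (c - G (grid_point m s))| <= lam * V.
  have /andP[g0 g1] := Gbnd _ (grid_point_in_cube m s).
  rewrite normrM gtr0_norm// ler_pM2l//; apply: le_trans (ler_normB _ _) _.
  by rewrite (ger0_norm g0); lra.
have v01 := soft_volume_itv m c.
have V0 : 0 <= lam * V by apply: le_trans (uV [::]); exact: normr_ge0.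
apply: gauss_le; rewrite (ger0_norm V0) ler_norml; apply/andP; split.
  rewrite le_Psi// -(coin_mean_cst (n * m.*2) (Phi _)); apply: coin_mean_le => s _.
  by rewrite Phi_mono; have := uV s; rewrite ler_norml => /andP[].
rewrite Psi_le// -(coin_mean_cst (n * m.*2) (Phi _)); apply: coin_mean_le => s _.
by rewrite Phi_mono; have := uV s; rewrite ler_norml => /andP[].
Qed.

(** The derivative of [Psi (vol m c)] is [dvol m c / I (vol m c)]. *)
Lemma soft_volume_expansion (c0 c1 e : R) : c0 <= c1 -> 0 < e -> 0 < s0 ->
  exists2 d0, 0 < d0 & forall m, (0 < m)%N -> (central_atom m : R) <= d0 ->
    (c1 - c0) * (lam / Num.sqrt (1 + lam ^+ 2) - e) <= Psi (vol m c1) - Psi (vol m c0).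
Proof.
move=> c01 e0 s00.
pose V := `|c0| + `|c1| + Gm; pose K := (phi (lam * V) * e) ^+ 2.
have K0 : 0 < K by rewrite exprn_gt0// mulr_gt0// gauss_gt0.
have B0 := grad_error_ge0 lam C (ltW lam0) C0.
pose nB := n%:R * grad_error lam C.
have nB0 : 0 <= nB by exact: mulr_ge0.
have nB1 : 0 < nB + 1 by lra.
exists (Num.min s0 (Num.min 1 (K / (nB + 1)))).
  by rewrite !lt_min s00 ltr01 divr_gt0.
move=> m m0; rewrite !le_min => /andP[ds /andP[d1 dK]].
have d0 := @central_atom_gt0 R m.
set r := Num.sqrt (1 + lam ^+ 2).
have r1 : 1 <= r.
  by rewrite -[leLHS]sqrtr1 ler_wsqrtr// lerDl sqr_ge0.
have lr : lam <= r.
  by rewrite -[leLHS](ger0_norm (ltW lam0)) -sqrtr_sqr ler_wsqrtr// lerDr.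
have err : Num.sqrt (nB * central_atom m) <= phi (lam * V) * e.
  have pe : 0 <= phi (lam * V) * e by rewrite mulr_ge0 ?(ltW (gauss_gt0 _)) ?(ltW e0).
  rewrite -[leRHS](ger0_norm pe) -sqrtr_sqr ler_wsqrtr//.
  apply: (@le_trans _ _ ((nB + 1) * central_atom m)); first by rewrite ler_wpM2r ?(ltW d0)//; lra.
  by rewrite mulrC -ler_pdivlMr.
pose k := lam / r - e.
suff : Psi (vol m c0) - k * c0 <= Psi (vol m c1) - k * c1 by rewrite -/k; lra.
apply: (@le_of_derive_ge0 R (fun c => Psi (vol m c) - k * c)
  (fun c => (phi (Psi (vol m c)))^-1 * dvol m c - k * 1) c0 c1 c01) => c.
  move=> _; have v01 := soft_volume_itv m c.
  have D1 := @is_derive1_comp R Psi (vol m) c _ _ (is_derive_Psi _ v01) (is_derive_soft_volume m c).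
  exact: is_deriveB D1 (is_deriveZ k (is_derive_id c (1 : R))).
move=> /andP[cc0 cc1].
have cV : `|c| + Gm <= V.
  rewrite lerD2r ler_norml; have n0 := ler_norm c0; have n1 := ler_norm c1.
  have m0' := ler_norm (- c0); have m1 := ler_norm (- c1); rewrite !normrN in m0' m1.
  have a0 := normr_ge0 c0; have a1 := normr_ge0 c1.
  by apply/andP; split; lra.
have Ige := soft_volume_profile_ge m c V cV.
have Igt : 0 < I (vol m c) by exact: gauss_profile_gt0.
have iso := soft_volume_isoperimetry m c m0 ds d1.
rewrite -/(I (vol m c)) mulr1 subr_ge0 mulrC ler_pdivlMr//.
have r0 : 0 < r by lra.
have eI : phi (lam * V) * e <= I (vol m c) * e by rewrite ler_pM2r.
have -> : k * I (vol m c) = lam / r * (I (vol m c) - I (vol m c) * e * (r / lam)).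
  by rewrite /k; field; rewrite !gt_eqF.
have -> : dvol m c = lam / r * (r * (dvol m c / lam)) by field; rewrite !gt_eqF.
rewrite ler_pM2l ?divr_gt0//.
have : I (vol m c) * e <= I (vol m c) * e * (r / lam).
  by rewrite ler_peMr ?mulr_ge0 ?(ltW Igt) ?(ltW e0)// ler_pdivlMr// mul1r.
by move: iso; rewrite -/nB -/r; lra.
Qed.

End expansion.

(** * Distance between bodies *)

Section distance.
Context {R : realType} {n : nat}.
Notation Psi := (@Phi_inv R).
Implicit Types A B : set (n.-tuple R).

Lemma central_atom_small (d : R) : 0 < d ->
  exists2 m, (0 < m)%N & (central_atom m : R) <= d.
Proof.
move=> d0; exists (Num.truncn ((d ^+ 2)^-1)).+1 => //.
set m := _.+1; have mlt : (d ^+ 2)^-1 < m%:R by exact: Num.Theory.truncnS_gt.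
have d2 : 0 < d ^+ 2 by rewrite exprn_gt0.
have w0 := @central_atom_gt0 R m.
have := @central_atom_sqr_le R m isT; rewrite leNgt => W; rewrite leNgt.
apply: contra W => dw.
have dw2 : d ^+ 2 < central_atom m ^+ 2 :> R by rewrite ltr_pXn2r// nnegrE ltW.
have md : 1 < m%:R * d ^+ 2 by rewrite -ltr_pdivrMr// mul1r.
have m0 : 0 < m%:R :> R by rewrite ltr0n.
have mdw : m%:R * d ^+ 2 < m%:R * central_atom m ^+ 2 :> R by rewrite ltr_pM2l.
have : m%:R * central_atom m ^+ 2 <= pi * (m%:R * central_atom m ^+ 2) :> R.
  rewrite -[leLHS]mul1r; apply: ler_wpM2r; first by rewrite mulr_ge0 ?sqr_ge0.
  by have := pi_ge2 R; lra.
by rewrite -mulrA; lra.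
Qed.

Lemma same_cell_close m (x : n.-tuple R) s j : same_cell n m.*2 x s ->
  `|grid_point m s j - tnth x j| <= central_atom m.
Proof.
move=> /(_ j); rewrite /grid_point => /andP[lo up].
have := @binomial_atom_le R m (block_count m.*2 j s).
move: up; rewrite binomial_cdfS => up at_le.
by rewrite ger0_norm; lra.
Qed.

Lemma tuple_in_cube (x : n.-tuple R) : unit_cube x -> in_cube (tnth x).
Proof. by move=> xc j; have /andP[? ?] := xc j; rewrite !ltW. Qed.

Lemma coin_mean_indicator_ge m A (eps : R) : A `<=` @unit_cube R n ->
  volume A = eps%:E ->
  eps <= coin_mean (n * m.*2) (fun s => `[< exists2 a, A a & same_cell n m.*2 a s >]%:R).
Proof. by move=> Ac vA; have := volume_le_coin_mean n m.*2 A Ac; rewrite vA lee_fin. Qed.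

Lemma volume_nonempty A (eps : R) : 0 < eps -> volume A = eps%:E -> exists a, A a.
Proof.
move=> e0 vA; apply: contrapT => noA.
have A0 : A = set0 by apply/seteqP; split=> // x Ax; case: noA; exists x.
move: vA; rewrite A0 /volume measure0 => -[] e; by rewrite -e ltxx in e0.
Qed.

Lemma set_dist_le_eucl A B a b : A a -> B b -> set_dist A B <= eucl_dist a b.
Proof.
move=> Aa Bb; apply: ge_inf; last by exists a => //; exists b.
by exists 0 => _ [x _] [y _] <-; exact: sqrtr_ge0.
Qed.

Lemma set_dist_sqr_le A B a b : 0 <= set_dist A B -> A a -> B b ->
  set_dist A B ^+ 2 <= sqdist (tnth b) (tnth a).
Proof.
move=> D0 Aa Bb; have := set_dist_le_eucl A B a b Aa Bb.
rewrite /eucl_dist => le.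
have -> : sqdist (tnth b) (tnth a) = \sum_(i < n) (tnth a i - tnth b i) ^+ 2.
  by apply: eq_bigr => i _; rewrite -sqrrN opprB.
rewrite -[leRHS]sqr_sqrtr; last by apply: sumr_ge0 => i _; exact: sqr_ge0.
by rewrite lerXn2r ?nnegrE ?sqrtr_ge0.
Qed.

(** The loss of speed caused by the smoothing vanishes for large [lam]. *)
Lemma slope_ge (lam : R) : 0 < lam -> 1 - (1 + lam)^-1 <= lam / Num.sqrt (1 + lam ^+ 2).
Proof.
move=> l0; have l1 : 0 < 1 + lam by lra.
have -> : 1 - (1 + lam)^-1 = lam / (1 + lam) by field; rewrite gt_eqF.
have s0 : 0 < Num.sqrt (1 + lam ^+ 2) by rewrite sqrtr_gt0 ltr_pwDl ?sqr_ge0.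
rewrite ler_pM2l// lef_pV2 ?posrE//.
rewrite -[leRHS](ger0_norm (ltW l1)) -sqrtr_sqr ler_wsqrtr//.
have -> : (1 + lam) ^+ 2 = 1 + lam ^+ 2 + 2 * lam by ring.
by rewrite lerDl mulr_ge0// ltW.
Qed.

(** Cells that meet [A] have soft distance at most [theta], hence soft level at
    least [Phi (lam * theta)] at [c = 2 theta]; cells that meet [B] have soft
    distance at least [D - theta], hence soft level at most
    [1 - Phi (lam * theta)] at [c = D - 2 theta].  Between these two values of [c]
    the quantile of the soft volume grows at nearly unit speed. *)
Lemma separated_bound A B (eps theta lam e : R) : 0 < eps < 1 ->
  A `<=` @unit_cube R n -> B `<=` @unit_cube R n ->
  volume A = eps%:E -> volume B = eps%:E ->
  0 < theta -> 0 < lam -> 0 < e -> 4 * theta <= set_dist A B ->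
  (set_dist A B - 4 * theta) * (lam / Num.sqrt (1 + lam ^+ 2) - e) <=
  - 2 * Psi (Phi (lam * theta) * eps).
Proof.
move=> /andP[eps0 eps1] Ac Bc vA vB th0 lam0 e0 thD.
set D := set_dist A B in thD *; have D0 : 0 <= D by lra.
have [a0 Aa0] := volume_nonempty A eps eps0 vA.
pose A' := [set tnth a | a in A].
have A'c x : A' x -> in_cube x by move=> [a /Ac/tuple_in_cube ? <-].
have [|G [C [s0 [Gm [C0 s00 slow Gbnd [near far]]]]]] :=
  @soft_distance_function R n A' (tnth a0) theta _ A'c th0; first by exists a0.
have c01 : 2 * theta <= D - 2 * theta by lra.
have [d0 d00 expand] := soft_volume_expansion G C s0 Gm lam C0 slow lam0 Gbnd
  (2 * theta) (D - 2 * theta) e c01 e0 s00.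
have [|m m0 md] := central_atom_small (Num.min d0 s0); first by rewrite lt_min d00.
have /andP[md0 ms0] : (central_atom m <= d0) && (central_atom m <= s0).
  by move: md; rewrite le_min.
have := expand m m0 md0.
have -> : D - 2 * theta - 2 * theta = D - 4 * theta by ring.
move=> /le_trans; apply.
set q := Phi (lam * theta) * eps.
have P0 := Phi_gt0 (lam * theta); have P1 := Phi_lt1 (lam * theta).
have q01 : 0 < q < 1.
  rewrite mulr_gt0//=; apply: (@le_lt_trans _ _ (1 * eps)); last by rewrite mul1r.
  by rewrite ler_pM2r// ltW.
have v0 := soft_volume_itv G lam m (2 * theta).
have v1 := soft_volume_itv G lam m (D - 2 * theta).
have lowA : q <= soft_volume G lam m (2 * theta).
  apply: (@le_trans _ _ (Phi (lam * theta) *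
    coin_mean (n * m.*2) (fun s => `[< exists2 a, A a & same_cell n m.*2 a s >]%:R))).
    by rewrite ler_pM2l// coin_mean_indicator_ge.
  rewrite -coin_meanZ; apply: coin_mean_le => s _.
  case: asboolP => [[a Aa as_]|_]; last by rewrite mulr0 ltW// Phi_gt0.
  rewrite mulr1 Phi_mono ler_pM2l//.
  suff : G (grid_point m s) <= theta by lra.
  apply: (near (tnth a)); [by exists a|exact: grid_point_in_cube|] => j.
  exact: le_trans (same_cell_close _ _ _ _ as_) ms0.
have upB : soft_volume G lam m (D - 2 * theta) <= 1 - q.
  apply: (@le_trans _ _ (1 + - Phi (lam * theta) *
    coin_mean (n * m.*2) (fun s => `[< exists2 b, B b & same_cell n m.*2 b s >]%:R))).
    rewrite -coin_meanZ -[X in _ <= X + _](coin_mean_cst (n * m.*2)) -coin_meanD.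
    apply: coin_mean_le => s _.
    case: asboolP => [[b Bb bs]|_]; last by rewrite mulr0 addr0 ltW// Phi_lt1.
    rewrite mulr1 -PhiN Phi_mono -(mulrN lam theta) ler_pM2l//.
    suff : D - theta <= G (grid_point m s) by lra.
    apply: (far D (tnth b)) => //.
    - exact/tuple_in_cube/Bc.
    - by move=> _ [a Aa <-]; exact: set_dist_sqr_le.
    - exact: grid_point_in_cube.
    - by move=> j; exact: le_trans (same_cell_close _ _ _ _ bs) ms0.
  by rewrite mulNr lerD2l lerN2 ler_pM2l// coin_mean_indicator_ge.
have PA : Psi q <= Psi (soft_volume G lam m (2 * theta)).
  by rewrite Psi_le// PsiK.
have PB : Psi (soft_volume G lam m (D - 2 * theta)) <= - Psi q.
  rewrite -PsiN// Psi_le// PsiK//.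
  by have /andP[q0 q1] := q01; apply/andP; split; lra.
by lra.
Qed.

Lemma set_dist_le A B (eps : R) : 0 < eps < 2^-1 ->
  A `<=` @unit_cube R n -> B `<=` @unit_cube R n ->
  volume A = eps%:E -> volume B = eps%:E ->
  set_dist A B <= - 2 * Psi eps.
Proof.
move=> /andP[eps0 eps2] Ac Bc vA vB; rewrite leNgt; apply/negP => gap.
have eps01 : 0 < eps < 1 by apply/andP; split; lra.
set z := - Psi eps; set D := set_dist A B in gap *.
(* Of the gap [gam], [theta] costs a quarter, the speed [lam / sqrt (1 + lam^2) - e]
   costs at most another quarter, and replacing [eps] by [Phi (lam * theta) * eps]
   costs a last quarter, through [z']. *)
pose gam := D - 2 * z; have gam0 : 0 < gam by rewrite /gam /z; lra.
have z0 : 0 < z.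
  rewrite oppr_gt0 ltNge le_Psi// -ltNge.
  by have := PhiN (0 : R); rewrite oppr0; lra.
pose z' := z + gam / 8.
have zz' : Phi (- z') < eps.
  rewrite -[ltRHS](PsiK eps)//; apply: Phi_lt; rewrite /z' /z; lra.
have [X PX] : exists X, Phi (- z') / eps < Phi X.
  by apply: Phi_gt; rewrite ltr_pdivrMr// mul1r.
pose theta := gam / 16; have th0 : 0 < theta by rewrite /theta; lra.
have D0 : 0 < D by rewrite /gam in gam0; lra.
pose lam := Num.max (8 * D / gam) (X / theta).
have lam1 : 8 * D / gam <= lam by rewrite le_max lexx.
have lam0 : 0 < lam by apply: lt_le_trans lam1; rewrite divr_gt0 ?mulr_gt0.
have lamX : X <= lam * theta by rewrite -ler_pdivrMr// le_max lexx orbT.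
pose e := gam / (8 * D); have e0 : 0 < e by rewrite divr_gt0 ?mulr_gt0.
have eV : (1 + lam)^-1 <= e.
  rewrite -[e]invrK lef_pV2 ?posrE ?invr_gt0//; last by lra.
  by rewrite /e invf_div; lra.
have thD : 4 * theta <= D by rewrite /theta; rewrite /gam; lra.
have := separated_bound A B eps theta lam e eps01 Ac Bc vA vB th0 lam0 e0 thD.
rewrite -/D => main.
have slope : 1 - gam / (4 * D) <= lam / Num.sqrt (1 + lam ^+ 2) - e.
  have := slope_ge lam lam0.
  have -> : gam / (4 * D) = 2 * e by rewrite /e; field; rewrite gt_eqF.
  by lra.
have q01 : 0 < Phi (lam * theta) * eps < 1.
  rewrite mulr_gt0 ?Phi_gt0//=; apply: (@le_lt_trans _ _ (1 * eps)); last by lra.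
  by rewrite ler_pM2r// ltW// Phi_lt1.
have qz : - z' <= Psi (Phi (lam * theta) * eps).
  rewrite le_Psi// -ler_pdivrMr//; apply: le_trans (ltW PX) _.
  by rewrite Phi_mono.
have low : (D - 4 * theta) * (1 - gam / (4 * D)) <= 2 * z'.
  apply: le_trans (_ : _ <= - 2 * Psi (Phi (lam * theta) * eps)) _; last by lra.
  by apply: le_trans main; rewrite ler_wpM2l// subr_ge0.
have expandE : (D - 4 * theta) * (1 - gam / (4 * D)) = D - gam / 2 + gam ^+ 2 / (16 * D).
  by rewrite /theta; field; rewrite gt_eqF.
have sq0 : 0 < gam ^+ 2 / (16 * D) by rewrite divr_gt0 ?exprn_gt0 ?mulr_gt0.
have DE : D = 2 * z + gam by rewrite /gam; ring.
by move: low; rewrite expandE /z'; lra.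
Qed.

End distance.

Theorem theorem4p3 (R : realType) :
  (forall (n : nat) (eps : R) (A B : set (n.-tuple R)),
     (1 <= n)%N -> 0 < eps < 2^-1 ->
     body A -> body B ->
     volume A = eps%:E -> volume B = eps%:E ->
     set_dist A B <= - 2 * Phi_inv eps)
  /\
  (- 2 * Phi_inv eps / (2 / Num.sqrt pi * Num.sqrt (- ln eps)))
    @[eps --> (0 : R)^'+] --> (1 : R).
Proof.
split; last exact: Phi_inv_asymptotics.
by move=> n eps A B _ eps02 [_ Ac] [_ Bc]; exact: set_dist_le.
Qed.
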